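(* Every bialgebra over $\mathbb{F}_2$ whose underlying algebra is isomorphic to $\mathbb{F}_2[x]/\langle x^4\rangle$ is a Hopf algebra, and up to isomorphism there are exactly four of these, namely the algebra $\mathbb{F}_2[x]/\langle x^4\rangle$ with $\epsilon(x)=0$ and one of: (i) $\Delta x=x\otimes1+1\otimes x$ (the anyonic line); (ii) $\Delta x=x\otimes1+1\otimes x+x\otimes x$ (the group Hopf algebra $\mathbb{F}_2\mathbb{Z}_4$, with $s=1+x$ grouplike); (iii) $\Delta x=x\otimes1+1\otimes x+x\otimes x+(x^2+x^3)\otimes(x^2+x^3)$, with antipode $Sx=x+x^2+x^3$; (iv) $\Delta x=x\otimes1+1\otimes x+x^2\otimes x^2$, with antipode $Sx=x$. Of these, (iv) is the only one that is self-dual.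
   Context: Algebras are unital associative; in a bialgebra the coproduct $\Delta$ and counit $\epsilon$ are unital algebra homomorphisms. Isomorphisms of bialgebras are linear bijections that are algebra and coalgebra maps. A finite-dimensional Hopf algebra $H$ is self-dual if it is isomorphic to its dual Hopf algebra $H^*$. *)

(* Defs.v *)
From HB Require Import structures.
From mathcomp Require Import all_boot all_order all_algebra all_fingroup all_field.

Set Implicit Arguments.
Unset Strict Implicit.
Unset Printing Implicit Defensive.

Import GRing.Theory.
Local Open Scope ring_scope.

Reserved Notation "u \ot v" (at level 40, no associativity, format "u  \ot  v").

Section Tensor.
Variable K : fieldType.
Implicit Types A B C D : vectType K.

Definition tbase A (i : 'I_(\dim {:A})) : A := (vbasis {:A})`_i.
Definition tcoord A (u : A) (i : 'I_(\dim {:A})) : K := coord (vbasis {:A}) i u.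

Lemma tcoordE A (u : A) : u = \sum_i tcoord u i *: tbase i.
Proof. exact/coord_vbasis/memvf. Qed.

Lemma tcoord_base A (i j : 'I_(\dim {:A})) : tcoord (tbase i) j = (i == j)%:R.
Proof. by rewrite /tcoord /tbase coord_free ?(basis_free (vbasisP _)). Qed.

(* The tensor product A (x) B is modelled by matrices of coordinates in the
   basis (tbase i (x) tbase j); its universal property is given by tensP,
   tlift_tens and tens_ind below. *)
Definition tensor A B : Type := 'M[K]_(\dim {:A}, \dim {:B}).
HB.instance Definition _ A B := Vector.copy (tensor A B) 'M[K]_(\dim {:A}, \dim {:B}).

Definition tens A B (u : A) (v : B) : tensor A B :=
  \matrix_(i, j) (tcoord u i * tcoord v j).
Local Notation "u \ot v" := (tens u v) : ring_scope.

Definition bilin A B C (f : A -> B -> C) :=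
  (forall a, linear (f a)) /\ (forall b, linear (f^~ b)).

Lemma tensP A B : bilin (@tens A B).
Proof.
split=> [a c x y|b c x y]; apply/matrixP=> i j; rewrite !mxE /tcoord linearP /=.
  by rewrite mulrDr mulrCA.
by rewrite mulrDl mulrA.
Qed.

Lemma tens_sum A B (X : tensor A B) :
  X = \sum_i \sum_j X i j *: (tbase i \ot tbase j).
Proof.
apply/matrixP=> i j; rewrite summxE (bigD1 i) //= summxE (bigD1 j) //=.
rewrite !mxE !tcoord_base !eqxx !mulr1 !big1 ?addr0 // => [k /negPf nk|k /negPf nk].
  rewrite summxE big1 // => l _.
  by rewrite !mxE !tcoord_base nk mul0r mulr0.
by rewrite !mxE !tcoord_base nk !mulr0.
Qed.

Lemma tens_ind A B (P : tensor A B -> Prop) :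
  P 0 -> (forall c X Y, P X -> P Y -> P (c *: X + Y)) ->
  (forall u v, P (u \ot v)) -> forall X, P X.
Proof.
move=> P0 PD Pt X; rewrite (tens_sum X).
have PS Y Z : P Y -> P Z -> P (Y + Z).
  by move=> PY PZ; rewrite -[Y]scale1r; apply: PD.
apply: (big_ind P) => // i _; apply: (big_ind P) => // j _.
by rewrite -[_ *: _]addr0; apply: PD.
Qed.

Lemma linear_zero A B (h : A -> B) : linear h -> h 0 = 0.
Proof. by move=> lh; move: (lh (-1) 0 0); rewrite scaler0 addr0 scaleN1r addNr. Qed.

Lemma linear_scale A B (h : A -> B) : linear h -> forall c a, h (c *: a) = c *: h a.
Proof. by move=> lh c a; rewrite -[c *: a]addr0 lh (linear_zero lh) addr0. Qed.

Lemma linear_tens_ext A B C (f g : tensor A B -> C) : linear f -> linear g ->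
  (forall u v, f (u \ot v) = g (u \ot v)) -> f =1 g.
Proof.
move=> lf lg efg; apply: tens_ind => // [|c X Y eX eY]; last by rewrite lf lg eX eY.
by rewrite !linear_zero.
Qed.

Definition tlift_fun A B C (f : A -> B -> C) (X : tensor A B) : C :=
  \sum_i \sum_j X i j *: f (tbase i) (tbase j).

Lemma tlift_fun_linear A B C (f : A -> B -> C) : linear (tlift_fun f).
Proof.
move=> c X Y; rewrite /tlift_fun scaler_sumr -big_split; apply: eq_bigr => i _ /=.
rewrite scaler_sumr -big_split; apply: eq_bigr => j _ /=.
by rewrite !mxE scalerDl scalerA.
Qed.

HB.instance Definition _ A B C (f : A -> B -> C) :=
  GRing.isLinear.Build K (tensor A B) C *:%R (tlift_fun f) (tlift_fun_linear f).

(* For bilinear f, the linear map A (x) B -> C sending a (x) b to f a b. *)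
Definition tlift A B C (f : A -> B -> C) : 'Hom(tensor A B, C) :=
  linfun (tlift_fun f).

Lemma linear_tbase A C (f : A -> C) : linear f ->
  forall a, f a = \sum_i tcoord a i *: f (tbase i).
Proof.
move=> fl a; pose fL : {linear A -> C} := HB.pack f (GRing.isLinear.Build _ _ _ _ f fl).
rewrite -[f]/(fL : _ -> _) [in LHS](tcoordE a) linear_sum.
by apply: eq_bigr => i _; rewrite linearZ.
Qed.

Lemma tlift_tens A B C (f : A -> B -> C) : bilin f ->
  forall a b, tlift f (a \ot b) = f a b.
Proof.
case=> fl fr a b; rewrite lfunE /= /tlift_fun (linear_tbase (fr b)).
apply: eq_bigr => i _; rewrite (linear_tbase (fl _) b) scaler_sumr.
by apply: eq_bigr => j _; rewrite scalerA mxE.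
Qed.

Lemma tlift_ext A B C (f g : A -> B -> C) : f =2 g -> tlift f = tlift g.
Proof.
move=> e; apply/lfunP=> X; rewrite !lfunE /= /tlift_fun.
by do 2![apply: eq_bigr => ? _]; rewrite e.
Qed.

Lemma tlift_param A B C (D : vectType K) (g : D -> A -> B -> C) X :
  (forall a b, linear (fun d => g d a b)) -> linear (fun d => tlift (g d) X).
Proof.
move=> lg c x y; rewrite !lfunE /= /tlift_fun.
rewrite scaler_sumr -big_split; apply: eq_bigr => i _ /=.
rewrite scaler_sumr -big_split; apply: eq_bigr => j _ /=.
by rewrite lg scalerDr !scalerA mulrC.
Qed.

Lemma bilin_comp A B C A' B' (f : A -> B -> C) (g : A' -> A) (h : B' -> B) :
  bilin f -> linear g -> linear h -> bilin (fun a b => f (g a) (h b)).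
Proof.
by case=> fl fr lg lh; split=> [a c x y|b c x y] /=; rewrite ?lh ?lg ?fl ?fr.
Qed.

Lemma linear_comb A B c (f g : A -> B) :
  linear f -> linear g -> linear (fun x => c *: f x + g x).
Proof.
by move=> lf lg d x y; rewrite lf lg !scalerDr !scalerA mulrC addrACA.
Qed.

(* f (x) g *)
Definition tmap A B C (D : vectType K) (f : 'Hom(A, C)) (g : 'Hom(B, D)) :
  'Hom(tensor A B, tensor C D) := tlift (fun a b => f a \ot g b).

Lemma linear_tlift A B C D (f : A -> B -> C) (h : C -> D) X :
  linear h -> h (tlift f X) = tlift (fun a b => h (f a b)) X.
Proof.
move=> lh; pose hL : {linear C -> D} := HB.pack h (GRing.isLinear.Build _ _ _ _ h lh).
rewrite !lfunE /= /tlift_fun -[h]/(hL : _ -> _) linear_sum; apply: eq_bigr => i _.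
by rewrite linear_sum; apply: eq_bigr => j _; rewrite linearZ.
Qed.

Lemma tlift_bilin_ext A B C (f g : A -> B -> C) X : f =2 g -> tlift f X = tlift g X.
Proof. by move=> e; rewrite (tlift_ext e). Qed.

Lemma tlift_tmap A B A' B' C (f : A' -> B' -> C) (g : 'Hom(A, A'))
    (h : 'Hom(B, B')) X :
  bilin f -> tlift f (tmap g h X) = tlift (fun a b => f (g a) (h b)) X.
Proof.
move=> bf; apply: etrans (linear_tlift _ _ (linearP (tlift f))) _.
by apply: tlift_bilin_ext => a b; rewrite /= tlift_tens.
Qed.

Lemma tmap_tens A B C D (f : 'Hom(A, C)) (g : 'Hom(B, D)) a b :
  tmap f g (a \ot b) = f a \ot g b.
Proof.
by rewrite /tmap tlift_tens //; apply: bilin_comp; [exact: tensP|exact: linearP..].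
Qed.

Lemma bilin_scale A : bilin (fun (c : K^o) (a : A) => c *: a).
Proof.
split=> [d c x y|a c x y]; first by rewrite scalerDr !scalerA mulrC.
by rewrite scalerDl scalerA.
Qed.

Lemma bilin_tassoc A B C :
  bilin (fun t (c : C) => tlift (fun (a : A) (b : B) => a \ot (b \ot c)) t).
Proof.
split=> [t|c]; last exact: linearP.
apply: tlift_param => a b c x y.
by rewrite (tensP B C).1 (tensP A (tensor B C)).1.
Qed.

(* (A (x) B) (x) C -> A (x) (B (x) C) *)
Definition tassoc A B C :
    'Hom(tensor (tensor A B) C, tensor A (tensor B C)) :=
  tlift (fun t c => tlift (fun a b => a \ot (b \ot c)) t).

Lemma tassoc_tens A B C (a : A) (b : B) (c : C) :
  tassoc A B C ((a \ot b) \ot c) = a \ot (b \ot c).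
Proof.
rewrite /tassoc tlift_tens ?tlift_tens //; last exact: bilin_tassoc.
apply: bilin_comp; [exact: tensP|by []|exact: (tensP B C).2].
Qed.

End Tensor.

Notation "u \ot v" := (tens u v) : ring_scope.

Section TensorAlgebra.
Variables (K : fieldType) (A B : falgType K).
Local Notation T := (tensor A B).

Lemma linear_mull (R : falgType K) (x : R) : linear (fun y => x * y).
Proof. by move=> c y z; rewrite mulrDr scalerAr. Qed.

Lemma linear_mulr (R : falgType K) (x : R) : linear (fun y => y * x).
Proof. by move=> c y z; rewrite mulrDl scalerAl. Qed.

(* (a (x) b) (a' (x) b') = a a' (x) b b' *)
Definition tmul (X Y : T) : T :=
  tlift (fun a b => tlift (fun a' b' => (a * a') \ot (b * b')) Y) X.
Definition tone : T := 1 \ot 1.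

Lemma tmul_bilin : bilin tmul.
Proof.
split=> [X|Y]; last exact: linearP.
by apply: tlift_param => a b; apply: linearP.
Qed.

Lemma tmul_tens a b a' b' : tmul (a \ot b) (a' \ot b') = (a * a') \ot (b * b').
Proof.
have bl x y : bilin (fun (a' : A) (b' : B) => (x * a') \ot (y * b')).
  by apply: bilin_comp (@tensP _ A B) _ _; apply: linear_mull.
rewrite /tmul tlift_tens ?tlift_tens //.
have br x y : bilin (fun (a : A) (b : B) => (a * x) \ot (b * y)).
  by apply: bilin_comp (@tensP _ A B) _ _; apply: linear_mulr.
split=> [u c x y|v c x y] /=.
  move: (a' \ot b'); apply: linear_tens_ext => [|d X Y|u' v'].
  - exact: linearP.
  - by apply: linear_comb; apply: linearP.
  - by rewrite !tlift_tens //; apply: (br _ _).1.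
move: (a' \ot b'); apply: linear_tens_ext => [|d X Y|u' v'].
- exact: linearP.
- by apply: linear_comb; apply: linearP.
- by rewrite !tlift_tens //; apply: (br _ _).2.
Qed.

Let lmul X : linear (tmul X) := tmul_bilin.1 X.
Let rmul X : linear (tmul^~ X) := tmul_bilin.2 X.

Lemma tmulA : associative tmul.
Proof.
move=> X Y Z; move: X; apply: linear_tens_ext => [c X X'|c X X'|a b].
- by rewrite rmul.
- by rewrite !rmul.
move: Y; apply: linear_tens_ext => [c Y Y'|c Y Y'|a' b'].
- by rewrite rmul lmul.
- by rewrite lmul rmul.
move: Z; apply: linear_tens_ext => [c Z Z'|c Z Z'|a'' b''].
- by rewrite !lmul.
- by rewrite lmul.
by rewrite !tmul_tens !mulrA.
Qed.

Lemma tmul1 : left_id tone tmul.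
Proof.
apply: linear_tens_ext => [||a b]; [exact: lmul|by []|].
by rewrite tmul_tens !mul1r.
Qed.

Lemma tmulr1 : right_id tone tmul.
Proof.
apply: linear_tens_ext => [||a b]; [exact: rmul|by []|].
by rewrite tmul_tens !mulr1.
Qed.

Lemma tmulDl : left_distributive tmul +%R.
Proof. by move=> X Y Z; have := rmul Z 1 X Y; rewrite !scale1r. Qed.

Lemma tmulDr : right_distributive tmul +%R.
Proof. by move=> X Y Z; have := lmul X 1 Y Z; rewrite !scale1r. Qed.

Lemma tcoord_neq0 (V : vectType K) (v : V) : v != 0 -> exists i, tcoord v i != 0.
Proof.
move=> nv; apply/existsP; apply: contraNT nv => /existsPn v0.
by rewrite (tcoordE v) big1 // => i _; move/negbNE/eqP: (v0 i) => ->; rewrite scale0r.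
Qed.

Lemma tone_neq0 : tone != 0.
Proof.
have [i ni] := tcoord_neq0 (oner_neq0 A); have [j nj] := tcoord_neq0 (oner_neq0 B).
apply: contraNneq (mulf_neq0 ni nj) => e.
by have /matrixP/(_ i j) := e; rewrite !mxE => ->.
Qed.

HB.instance Definition _ := GRing.Zmodule_isNzRing.Build T
  tmulA tmul1 tmulr1 tmulDl tmulDr tone_neq0.

Lemma tscaleAl (c : K) (X Y : T) : c *: (X * Y) = (c *: X) * Y.
Proof. exact/esym/(linear_scale (rmul Y)). Qed.

Lemma tscaleAr (c : K) (X Y : T) : c *: (X * Y) = X * (c *: Y).
Proof. exact/esym/(linear_scale (lmul X)). Qed.

HB.instance Definition _ := GRing.Lmodule_isLalgebra.Build K T tscaleAl.
HB.instance Definition _ := GRing.Lalgebra_isAlgebra.Build K T tscaleAr.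
HB.instance Definition _ := Algebra_isFalgebra.Build K T.

Lemma tens_mul (a a' : A) (b b' : B) : (a \ot b) * (a' \ot b') = (a * a') \ot (b * b').
Proof. exact: tmul_tens. Qed.

Lemma tens_one : 1 \ot 1 = 1 :> T. Proof. by []. Qed.

End TensorAlgebra.

Section Bialgebra.
Variable K : fieldType.

Definition alg_iso (A B : falgType K) := exists f : 'AHom(A, B), bijective f.

(* 'AHom is the type of unital algebra homomorphisms. *)
Record bialgebra (A : falgType K) := Bialgebra {
  coprod : 'AHom(A, tensor A A);
  counit : 'AHom(A, K^o);
  coprodA : forall a,
    tassoc A A A (tmap coprod \1%VF (coprod a)) = tmap \1%VF coprod (coprod a);
  counitl : forall a, tlift (fun u v => counit u *: v) (coprod a) = a;
  counitr : forall a, tlift (fun u v => counit v *: u) (coprod a) = a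
}.

Definition is_antipode (A : falgType K) (B : bialgebra A) (S : 'End(A)) :=
  forall a, tlift (fun u v => S u * v) (coprod B a) = (counit B a)%:A
         /\ tlift (fun u v => u * S v) (coprod B a) = (counit B a)%:A.

Definition is_hopf (A : falgType K) (B : bialgebra A) :=
  exists S : 'End(A), is_antipode B S.

Definition is_bialg_iso (A A' : falgType K) (B : bialgebra A)
    (B' : bialgebra A') (f : 'AHom(A, A')) :=
  [/\ bijective f,
      forall a, coprod B' (f a) = tmap f f (coprod B a)
    & forall a, counit B' (f a) = counit B a].

Definition bialg_iso (A A' : falgType K) (B : bialgebra A) (B' : bialgebra A') :=
  exists f : 'AHom(A, A'), is_bialg_iso B B' f.

Definition grouplike (A : falgType K) (B : bialgebra A) (s : A) :=
  coprod B s = s \ot s /\ counit B s = 1.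

End Bialgebra.

HB.instance Definition _ (K : fieldType) (h : {poly K}) := Vector.on {poly %/ h}.


Section Dual.
Variables (K : fieldType) (A : falgType K) (B : bialgebra A).

(* The dual H^*, with the structure transposed from that of H: product
   (f g)(a) = (f (x) g)(coprod a), unit the counit of H, coproduct determined
   by <coprod f, a (x) b> = f (a b), and counit f |-> f 1. *)
Definition dual : Type := 'Hom(A, K^o).
HB.instance Definition _ := Vector.copy dual 'Hom(A, K^o).

Lemma dual_linear (f : dual) : linear f. Proof. exact: linearP. Qed.
Lemma dualP (f g : dual) : f =1 g -> f = g. Proof. by move/lfunP. Qed.
Lemma dual_eval a : linear (fun f : dual => f a).
Proof. by move=> c f g; rewrite /= add_lfunE scale_lfunE. Qed.

Lemma bilin_mul : bilin (fun x y : K^o => x * y).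
Proof. by split=> x; [exact: linear_mull|exact: linear_mulr]. Qed.

Definition fpair (f g : dual) : 'Hom(tensor A A, K^o) := tlift (fun u v => f u * g v).

Lemma fpair_bilin (f g : dual) : bilin (fun u v => f u * g v).
Proof. by apply: bilin_comp bilin_mul _ _; exact: dual_linear. Qed.

Lemma fpair_tens f g u v : fpair f g (u \ot v) = f u * g v.
Proof. by rewrite /fpair tlift_tens //; apply: fpair_bilin. Qed.

Lemma fpair_param X : bilin (fun f g : dual => fpair f g X).
Proof.
split=> [f|g]; apply: tlift_param => u v c x y; rewrite dual_eval.
  exact: bilin_mul.1.
exact: bilin_mul.2.
Qed.

Definition dual_mul (f g : dual) : dual := (fpair f g \o coprod B)%VF.
Definition dual_one : dual := counit B.

Lemma dual_mulE f g a : dual_mul f g a = fpair f g (coprod B a).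
Proof. exact: comp_lfunE. Qed.

Lemma dual_mulA : associative dual_mul.
Proof.
move=> f g h; apply: dualP => a; rewrite !dual_mulE.
have bG : bilin (fun u t => f u * fpair g h t).
  by apply: bilin_comp bilin_mul _ _; [exact: dual_linear|exact: linearP].
have bF : bilin (fun t w => fpair f g t * h w).
  by apply: bilin_comp bilin_mul _ _; [exact: linearP|exact: dual_linear].
transitivity (tlift (fun u t => f u * fpair g h t) (tmap \1%VF (coprod B) (coprod B a))).
  rewrite tlift_tmap //; apply: tlift_bilin_ext => u v.
  by rewrite id_lfunE dual_mulE.
transitivity (tlift (fun t w => fpair f g t * h w) (tmap (coprod B) \1%VF (coprod B a))).
  rewrite -coprodA; move: (tmap _ _ _); apply: linear_tens_ext => [c X Y|c X Y|t w].
  - by rewrite !linearP.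
  - exact: linearP.
  rewrite [RHS]tlift_tens //; move: t; apply: linear_tens_ext => [c X Y|c X Y|u v].
  - by rewrite (tensP _ _).2 !linearP.
  - exact: (bF.2 w).
  by rewrite tassoc_tens tlift_tens // !fpair_tens mulrA.
rewrite tlift_tmap //; apply: tlift_bilin_ext => u v.
by rewrite id_lfunE dual_mulE.
Qed.

Lemma dual_mul1 : left_id dual_one dual_mul.
Proof.
move=> f; apply: dualP => a; rewrite dual_mulE -[in RHS](counitl B a).
rewrite (linear_tlift _ _ (dual_linear f)); apply: tlift_bilin_ext => u v.
by rewrite (linear_scale (dual_linear f)).
Qed.

Lemma dual_mulr1 : right_id dual_one dual_mul.
Proof.
move=> f; apply: dualP => a; rewrite dual_mulE -[in RHS](counitr B a).
rewrite (linear_tlift _ _ (dual_linear f)); apply: tlift_bilin_ext => u v.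
by rewrite (linear_scale (dual_linear f)) mulrC.
Qed.

Lemma dual_mul_bilin : bilin dual_mul.
Proof.
split=> [f c g h|g c f h]; apply: dualP => a; rewrite dual_eval !dual_mulE.
  exact: (fpair_param _).1.
exact: (fpair_param _).2.
Qed.

Let lmul f : linear (dual_mul f) := dual_mul_bilin.1 f.
Let rmul f : linear (dual_mul^~ f) := dual_mul_bilin.2 f.

Lemma dual_mulDl : left_distributive dual_mul +%R.
Proof. by move=> f g h; have := rmul h 1 f g; rewrite !scale1r. Qed.

Lemma dual_mulDr : right_distributive dual_mul +%R.
Proof. by move=> f g h; have := lmul f 1 g h; rewrite !scale1r. Qed.

Lemma dual_one_neq0 : dual_one != 0.
Proof.
apply: contraNneq (oner_neq0 K) => e; apply/eqP.
transitivity (fun_of_lfun dual_one 1); first exact/esym/(rmorph1 (counit B)).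
by rewrite e zero_lfunE.
Qed.

HB.instance Definition _ := GRing.Zmodule_isNzRing.Build dual
  dual_mulA dual_mul1 dual_mulr1 dual_mulDl dual_mulDr dual_one_neq0.

Lemma dual_scaleAl (c : K) (f g : dual) : c *: (f * g) = (c *: f) * g.
Proof. exact/esym/(linear_scale (rmul g)). Qed.

Lemma dual_scaleAr (c : K) (f g : dual) : c *: (f * g) = f * (c *: g).
Proof. exact/esym/(linear_scale (lmul f)). Qed.

HB.instance Definition _ := GRing.Lmodule_isLalgebra.Build K dual dual_scaleAl.
HB.instance Definition _ := GRing.Lalgebra_isAlgebra.Build K dual dual_scaleAr.
HB.instance Definition _ := Algebra_isFalgebra.Build K dual.

Definition dual_base (i : 'I_(\dim {:A})) : dual := linfun (coord (vbasis {:A}) i : A -> K^o).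

Lemma dual_baseE i a : dual_base i a = tcoord a i.
Proof. by rewrite lfunE. Qed.

Lemma dual_sum (f : dual) : f = \sum_i f (tbase i) *: dual_base i.
Proof.
apply: dualP => a; rewrite (linear_tbase (dual_linear f) a) sum_lfunE.
by apply: eq_bigr => i _; rewrite scale_lfunE lfunE; apply: mulrC.
Qed.

(* <f (x) g, a (x) b> = f a * g b *)
Definition dual_ev a b : 'Hom(tensor dual dual, K^o) := tlift (fun f g : dual => f a * g b).

Lemma dual_ev_bilin a b : bilin (fun f g : dual => f a * g b).
Proof. by apply: bilin_comp bilin_mul _ _; exact: dual_eval. Qed.

Lemma dual_ev_tens a b f g : dual_ev a b (f \ot g) = f a * g b.
Proof. by rewrite /dual_ev tlift_tens //; apply: dual_ev_bilin. Qed.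

Lemma dual_ev_param X : bilin (fun a b => dual_ev a b X).
Proof.
split=> [a|b]; apply: tlift_param => f g c x y; rewrite dual_linear.
  exact: bilin_mul.1.
exact: bilin_mul.2.
Qed.

(* partial evaluation f (x) v |-> f a *: v *)
Definition dual_pev (V : vectType K) a : 'Hom(tensor dual V, V) :=
  tlift (fun (f : dual) v => f a *: v).

Lemma dual_pev_bilin (V : vectType K) a : bilin (fun (f : dual) (v : V) => f a *: v).
Proof. by apply: bilin_comp (bilin_scale V) _ _ => //; exact: dual_eval. Qed.

Lemma dual_pev_tens (V : vectType K) a f (v : V) : dual_pev V a (f \ot v) = f a *: v.
Proof. by rewrite /dual_pev tlift_tens //; apply: dual_pev_bilin. Qed.

Lemma dual_pev_sum (V : vectType K) (X : tensor dual V) :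
  X = \sum_i (dual_base i \ot dual_pev V (tbase i) X).
Proof.
move: X; apply: linear_tens_ext => [c X Y //|c X Y|f v].
  rewrite scaler_sumr -big_split; apply: eq_bigr => i _ /=.
  by rewrite linearP (tensP _ _).1.
have lv : linear (fun g : dual => g \ot v) := (tensP _ _).2 v.
pose L : {linear dual -> tensor dual V} := HB.pack (fun g : dual => g \ot v)
  (GRing.isLinear.Build _ _ _ _ (fun g : dual => g \ot v) lv).
rewrite -[LHS]/(L f) [in LHS](dual_sum f) linear_sum; apply: eq_bigr => i _.
rewrite linearZ /= dual_pev_tens.
by rewrite (linear_scale ((tensP _ _).1 (dual_base i))).
Qed.

Lemma dual_pev_inj (V : vectType K) (X Y : tensor dual V) :
  (forall a, dual_pev V a X = dual_pev V a Y) -> X = Y.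
Proof.
by move=> e; rewrite (dual_pev_sum X) (dual_pev_sum Y); apply: eq_bigr => i _; rewrite e.
Qed.

Lemma dual_pev_ev a b X : fun_of_lfun (dual_pev dual a X) b = dual_ev a b X.
Proof.
move: X; apply: linear_tens_ext => [c X Y|c X Y|f g]; rewrite ?linearP //.
  exact: dual_eval.
by rewrite dual_pev_tens dual_ev_tens (linear_scale (dual_eval b)).
Qed.

Lemma dual_ev_inj X Y : (forall a b, dual_ev a b X = dual_ev a b Y) -> X = Y.
Proof.
move=> e; apply: dual_pev_inj => a; apply: dualP => b.
by rewrite !dual_pev_ev.
Qed.

Definition dual_coprod_fun (f : dual) : tensor dual dual :=
  \sum_i \sum_j f (tbase i * tbase j) *: (dual_base i \ot dual_base j).

Lemma dual_coprodE f a b : dual_ev a b (dual_coprod_fun f) = f (a * b).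
Proof.
have lf := dual_linear f.
have l1 : linear (fun x => f (x * b)) by move=> c x y; rewrite mulrDl -scalerAl lf.
have l2 x : linear (fun y => f (x * y)) by move=> c y z; rewrite mulrDr -scalerAr lf.
rewrite (linear_tbase l1) linear_sum; apply: eq_bigr => i _ /=.
rewrite linear_sum (linear_tbase (l2 _) b) scaler_sumr; apply: eq_bigr => j _ /=.
by rewrite linearZ /= dual_ev_tens !dual_baseE scalerA [RHS]mulrC.
Qed.

Lemma dual_coprod_linear : linear dual_coprod_fun.
Proof.
move=> c f g; apply: dual_ev_inj => a b.
by rewrite linearP /= !dual_coprodE dual_eval.
Qed.

Lemma dual_ev_mul a b (X Y : tensor dual dual) :
  dual_ev a b (X * Y) =
  tlift (fun u v => tlift (fun u' v' => dual_ev u u' X * dual_ev v v' Y) (coprod B b))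
    (coprod B a).
Proof.
have Ql Y' : linear (fun X => tlift (fun u v => tlift (fun u' v' =>
    dual_ev u u' X * dual_ev v v' Y') (coprod B b)) (coprod B a)).
  apply: tlift_param => u v; apply: tlift_param => u' v' c x y.
  by rewrite linearP; apply: bilin_mul.2.
have Qr X' : linear (fun Y => tlift (fun u v => tlift (fun u' v' =>
    dual_ev u u' X' * dual_ev v v' Y) (coprod B b)) (coprod B a)).
  apply: tlift_param => u v; apply: tlift_param => u' v' c x y.
  by rewrite linearP; apply: bilin_mul.1.
move: X; apply: linear_tens_ext => [c X X'|c X X'|f f'].
- by rewrite linear_mulr linearP.
- exact: Ql.
move: Y; apply: linear_tens_ext => [c Y Y'|c Y Y'|g g'].
- by rewrite linear_mull linearP.
- exact: Qr.
rewrite tens_mul dual_ev_tens [fun_of_lfun _ a]dual_mulE [fun_of_lfun _ b]dual_mulE.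
rewrite (linear_tlift _ _ (linear_mulr (R := K^o) _)); apply: tlift_bilin_ext => u v.
rewrite (linear_tlift _ _ (linear_mull (R := K^o) _)); apply: tlift_bilin_ext => u' v'.
by rewrite !dual_ev_tens mulrACA.
Qed.

HB.instance Definition _ := GRing.isLinear.Build K dual (tensor dual dual) *:%R
  dual_coprod_fun dual_coprod_linear.

Lemma dual_coprod_is_monoid_morphism : monoid_morphism dual_coprod_fun.
Proof.
split=> [|f g]; apply: dual_ev_inj => a b; rewrite dual_coprodE.
  by rewrite -tens_one dual_ev_tens /= rmorphM.
rewrite [RHS]dual_ev_mul [LHS]dual_mulE rmorphM /=.
have lf (h : dual) x : linear (fun y => h (x * y)).
  by move=> c y z; rewrite (linear_mull x) dual_linear.
have rf (h : dual) x : linear (fun y => h (y * x)).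
  by move=> c y z; rewrite (linear_mulr x) dual_linear.
have bl u v : bilin (fun u' v' => dual_ev u u' (dual_coprod_fun f) *
    dual_ev v v' (dual_coprod_fun g)).
  split=> [u' c x y|v' c x y].
    by rewrite (dual_ev_param _).1; apply: bilin_mul.1.
  by rewrite (dual_ev_param _).1; apply: bilin_mul.2.
have br P : bilin (fun u v => tlift (fun u' v' => dual_ev u u' (dual_coprod_fun f) *
    dual_ev v v' (dual_coprod_fun g)) P).
  split=> [u|v]; apply: tlift_param => u' v' c x y.
    by rewrite (dual_ev_param _).2; apply: bilin_mul.1.
  by rewrite (dual_ev_param _).2; apply: bilin_mul.2.
move: (coprod B b) => P; move: (coprod B a).
apply: linear_tens_ext => [c X Y|c X Y|u v].
- by rewrite linear_mulr linearP.
- exact: linearP.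
rewrite tlift_tens //; move: P; apply: linear_tens_ext => [c X Y|c X Y|u' v'].
- by rewrite linear_mull linearP.
- exact: linearP.
by rewrite tlift_tens // tens_mul fpair_tens !dual_coprodE.
Qed.

HB.instance Definition _ := GRing.isMonoidMorphism.Build dual (tensor dual dual)
  dual_coprod_fun dual_coprod_is_monoid_morphism.

Definition dual_coprod : 'AHom(dual, tensor dual dual) := linfun_ahom dual_coprod_fun.

Definition dual_counit_fun (f : dual) : K^o := f 1.

Lemma dual_counit_is_monoid_morphism : monoid_morphism dual_counit_fun.
Proof.
split=> [|f g]; first by rewrite /dual_counit_fun /= rmorph1.
by rewrite /dual_counit_fun [LHS]dual_mulE rmorph1 -tens_one fpair_tens.
Qed.

HB.instance Definition _ := GRing.isLinear.Build K dual K^o *:%R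
  dual_counit_fun (dual_eval 1).
HB.instance Definition _ := GRing.isMonoidMorphism.Build dual K^o
  dual_counit_fun dual_counit_is_monoid_morphism.

Definition dual_counit : 'AHom(dual, K^o) := linfun_ahom dual_counit_fun.

Lemma dual_coprodP f a b : dual_ev a b (dual_coprod f) = f (a * b).
Proof. exact: etrans (congr1 (dual_ev a b) (lfunE _ f)) (dual_coprodE f a b). Qed.

Lemma dual_counitP f : dual_counit f = f 1.
Proof. by rewrite /= lfunE. Qed.

Lemma dual_ev3_tassoc a b c T (h : dual) :
  dual_ev b c (dual_pev _ a (tassoc _ _ _ (T \ot h))) = dual_ev a b T * h c.
Proof.
move: T; apply: linear_tens_ext => [d X Y|d X Y|f g].
- by rewrite (tensP _ _).2 !linearP.
- by rewrite linearP; apply: bilin_mul.2.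
by rewrite tassoc_tens dual_pev_tens linearZ /= !dual_ev_tens; apply: mulrA.
Qed.

Lemma dual_coprodA f :
  tassoc dual dual dual (tmap dual_coprod \1%VF (dual_coprod f)) =
  tmap \1%VF dual_coprod (dual_coprod f).
Proof.
apply: dual_pev_inj => a; apply: dual_ev_inj => b c.
transitivity (dual_ev (a * b) c (dual_coprod f)).
  have hl : linear (fun Z => dual_ev b c (dual_pev _ a (tassoc dual dual dual Z))).
    by move=> d X Y; rewrite !linearP.
  apply: etrans (linear_tlift _ _ hl) _.
  apply: tlift_bilin_ext => g h.
  by rewrite dual_ev3_tassoc dual_coprodP id_lfunE.
transitivity (dual_ev a (b * c) (dual_coprod f)); first by rewrite !dual_coprodP mulrA.
have hl : linear (fun Z => dual_ev b c (dual_pev (tensor dual dual) a Z)).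
  by move=> d X Y; rewrite !linearP.
apply: esym; apply: etrans (linear_tlift _ _ hl) _.
apply: tlift_bilin_ext => g h.
by rewrite dual_pev_tens linearZ /= dual_coprodP id_lfunE.
Qed.

Lemma dual_counitl f : tlift (fun g h => dual_counit g *: h) (dual_coprod f) = f.
Proof.
apply: dualP => b; rewrite -[in RHS](mul1r b) -dual_coprodP.
rewrite (linear_tlift _ _ (dual_eval b)); apply: tlift_bilin_ext => g h.
by rewrite dual_counitP (linear_scale (dual_eval b)).
Qed.

Lemma dual_counitr f : tlift (fun g h => dual_counit h *: g) (dual_coprod f) = f.
Proof.
apply: dualP => b; rewrite -[in RHS](mulr1 b) -dual_coprodP.
rewrite (linear_tlift _ _ (dual_eval b)); apply: tlift_bilin_ext => g h.
by rewrite dual_counitP (linear_scale (dual_eval b)) mulrC.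
Qed.

Definition dual_bialgebra : bialgebra dual :=
  Bialgebra dual_coprodA dual_counitl dual_counitr.

Lemma dual_convolution (F G : A -> A) (L M : dual -> dual) :
  linear F -> linear G ->
  (forall g u, L g u = g (F u)) -> (forall h v, M h v = h (G v)) ->
  forall f a, fun_of_lfun (tlift (fun g h => L g * M h) (dual_coprod f)) a =
              f (tlift (fun u v => F u * G v) (coprod B a)).
Proof.
move=> lF lG LE ME f a; apply: etrans (linear_tlift _ _ (dual_eval a)) _.
transitivity (tlift (fun g h => fpair (L g) (M h) (coprod B a)) (dual_coprod f)).
  by apply: tlift_bilin_ext => g h; apply: dual_mulE.
move: (coprod B a); apply: linear_tens_ext => [|c X Y|u v].
- by apply: tlift_param => g h; apply: linearP.
- by rewrite linearP dual_linear.
rewrite tlift_tens; last by split=> [x|x] c y z; rewrite ?lF ?lG ?linear_mull ?linear_mulr.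
rewrite -dual_coprodP; apply: tlift_bilin_ext => g h.
by rewrite fpair_tens LE ME.
Qed.

(* The antipode of the dual Hopf algebra is the transpose of the antipode. *)
Lemma dual_antipode (S : 'End(A)) : is_antipode B S ->
  is_antipode dual_bialgebra (linfun (fun f : dual => (f \o S)%VF : dual)).
Proof.
have lS : linear (fun f : dual => (f \o S)%VF : dual).
  by move=> c f g; apply: dualP => a; rewrite dual_eval !comp_lfunE dual_eval.
pose L : {linear dual -> dual} := HB.pack (fun f : dual => (f \o S)%VF : dual)
  (GRing.isLinear.Build _ _ _ _ (fun f : dual => (f \o S)%VF : dual) lS).
have LE (f : dual) u : fun_of_lfun (linfun L f) u = f (S u).
  by rewrite lfunE comp_lfunE.
have cE (f : dual) a : f ((counit B a)%:A) = ((dual_counit f)%:A : dual) a.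
  by rewrite (linear_scale (dual_linear f)) scale_lfunE dual_counitP; apply: mulrC.
move=> aS f; split; apply: dualP => a; have [aSl aSr] := aS a.
- rewrite (@dual_convolution S id (linfun L) id) ?aSl ?cE //; exact: linearP.
rewrite (@dual_convolution id S id (linfun L)) ?aSr ?cE //; exact: linearP.
Qed.

End Dual.

(* An isomorphism of bialgebras between Hopf algebras automatically respects
   the antipodes, so this is also isomorphism of Hopf algebras. *)
Definition self_dual (K : fieldType) (A : falgType K) (B : bialgebra A) :=
  bialg_iso B (dual_bialgebra B).

Section GroupAlgebra.
Variables (K : fieldType) (gT : finGroupType).

(* The group algebra K[gT]: a function f stands for the formal sum
   \sum_g f g *: [g], where [g] is galg_elt g. *)
Definition galg : Type := {ffun gT -> K^o}.
HB.instance Definition _ := Vector.copy galg {ffun gT -> K^o}.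

Definition galg_elt (g : gT) : galg := [ffun x => (x == g)%:R].

Definition glift (V : vectType K) (F : gT -> V) (f : galg) : V := \sum_g f g *: F g.

Lemma glift_linear (V : vectType K) (F : gT -> V) : linear (glift F).
Proof.
move=> c f h; rewrite /glift scaler_sumr -big_split; apply: eq_bigr => g _ /=.
by rewrite !ffunE scalerDl scalerA.
Qed.

Lemma glift_elt (V : vectType K) (F : gT -> V) g : glift F (galg_elt g) = F g.
Proof.
rewrite /glift (bigD1 g) //= ffunE eqxx scale1r big1 ?addr0 // => x /negPf nx.
by rewrite ffunE nx scale0r.
Qed.

Lemma galg_sum f : f = glift galg_elt f.
Proof.
apply/ffunP=> x; rewrite /glift sum_ffunE (bigD1 x) //= big1 ?addr0 => [|y ny].
  by rewrite !ffunE eqxx; apply/esym/mulr1.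
by rewrite !ffunE eq_sym (negPf ny); apply: mulr0.
Qed.

Lemma linear_glift (V W : vectType K) (F : gT -> V) (h : V -> W) f :
  linear h -> h (glift F f) = glift (h \o F) f.
Proof.
move=> lh; pose hL : {linear V -> W} := HB.pack h (GRing.isLinear.Build _ _ _ _ h lh).
rewrite /glift -[h]/(hL : _ -> _) linear_sum; apply: eq_bigr => g _.
by rewrite linearZ.
Qed.

Lemma linear_galg_ext (V : vectType K) (h k : galg -> V) : linear h -> linear k ->
  (forall g, h (galg_elt g) = k (galg_elt g)) -> h =1 k.
Proof.
move=> lh lk e f; rewrite (galg_sum f) (linear_glift _ _ lh) (linear_glift _ _ lk).
by apply: eq_bigr => g _; rewrite /= e.
Qed.

(* [g] * [h] = [g h] *)
Definition galg_mul (f h : galg) : galg :=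
  glift (fun x => glift (fun y => galg_elt (x * y)%g) h) f.

Lemma galg_mul_elt g h : galg_mul (galg_elt g) (galg_elt h) = galg_elt (g * h)%g.
Proof. by rewrite /galg_mul !glift_elt. Qed.

Let rmul h : linear (galg_mul^~ h). Proof. exact: glift_linear. Qed.

Let lmul f : linear (galg_mul f).
Proof.
move=> c h k; move: f; apply: linear_galg_ext => [||g]; first exact: rmul.
  by apply: linear_comb; apply: rmul.
by rewrite /galg_mul !glift_elt glift_linear.
Qed.

Lemma galg_mulA : associative galg_mul.
Proof.
move=> f h k; move: f; apply: linear_galg_ext => [|c f f'|f]; first exact: rmul.
  by rewrite !rmul.
move: h; apply: linear_galg_ext => [c h h'|c h h'|h].
- by rewrite rmul lmul.
- by rewrite lmul rmul.
move: k; apply: linear_galg_ext => [c k k'|c k k'|k].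
- by rewrite !lmul.
- by rewrite lmul.
by rewrite !galg_mul_elt mulgA.
Qed.

Lemma galg_mul1 : left_id (galg_elt 1%g) galg_mul.
Proof.
apply: linear_galg_ext => [||g]; [exact: lmul|by []|].
by rewrite galg_mul_elt mul1g.
Qed.

Lemma galg_mulr1 : right_id (galg_elt 1%g) galg_mul.
Proof.
apply: linear_galg_ext => [||g]; [exact: rmul|by []|].
by rewrite galg_mul_elt mulg1.
Qed.

Lemma galg_mulDl : left_distributive galg_mul +%R.
Proof. by move=> f g h; have := rmul h 1 f g; rewrite !scale1r. Qed.

Lemma galg_mulDr : right_distributive galg_mul +%R.
Proof. by move=> f g h; have := lmul f 1 g h; rewrite !scale1r. Qed.

Lemma galg_one_neq0 : galg_elt 1%g != 0.
Proof.
apply: contraNneq (oner_neq0 K) => e; apply/eqP.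
by have /ffunP/(_ 1%g) := e; rewrite !ffunE eqxx.
Qed.

HB.instance Definition _ := GRing.Zmodule_isNzRing.Build galg
  galg_mulA galg_mul1 galg_mulr1 galg_mulDl galg_mulDr galg_one_neq0.

Lemma galg_scaleAl (c : K) (f h : galg) : c *: (f * h) = (c *: f) * h.
Proof. exact/esym/(linear_scale (rmul h)). Qed.

Lemma galg_scaleAr (c : K) (f h : galg) : c *: (f * h) = f * (c *: h).
Proof. exact/esym/(linear_scale (lmul f)). Qed.

HB.instance Definition _ := GRing.Lmodule_isLalgebra.Build K galg galg_scaleAl.
HB.instance Definition _ := GRing.Lalgebra_isAlgebra.Build K galg galg_scaleAr.
HB.instance Definition _ := Algebra_isFalgebra.Build K galg.

Lemma glift_is_monoid_morphism (W : falgType K) (F : gT -> W) :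
  F 1%g = 1 -> {morph F : g h / (g * h)%g >-> g * h} -> monoid_morphism (glift F).
Proof.
move=> F1 FM; have lF := glift_linear F.
split=> [|f h]; first by rewrite -F1; apply: glift_elt.
move: f; apply: linear_galg_ext => [c f f'|c f f'|f].
- by rewrite linear_mulr lF.
- by rewrite lF linear_mulr.
move: h; apply: linear_galg_ext => [c h h'|c h h'|h].
- by rewrite linear_mull lF.
- by rewrite lF linear_mull.
by rewrite [_ * _]galg_mul_elt !glift_elt FM.
Qed.

HB.instance Definition _ (V : vectType K) (F : gT -> V) :=
  GRing.isLinear.Build K galg V *:%R (glift F) (glift_linear F).

Lemma glift_is_ahom (W : falgType K) (F : gT -> W) : F 1%g = 1 ->
  {morph F : g h / (g * h)%g >-> g * h} -> ahom_in fullv (linfun (glift F)).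
Proof.
move=> F1 FM; have [G1 GM] := glift_is_monoid_morphism F1 FM.
by apply/ahom_inP; split=> [x y _ _|]; rewrite !lfunE /= ?GM ?G1.
Qed.

Definition glift_ahom (W : falgType K) (F : gT -> W) (F1 : F 1%g = 1)
    (FM : {morph F : g h / (g * h)%g >-> g * h}) : 'AHom(galg, W) :=
  AHom (glift_is_ahom F1 FM).

Lemma glift_ahomE (W : falgType K) (F : gT -> W) F1 FM g :
  @glift_ahom W F F1 FM (galg_elt g) = F g.
Proof. by rewrite lfunE /= glift_elt. Qed.

Lemma galg_grouplike1 : galg_elt 1%g \ot galg_elt 1%g = 1 :> tensor galg galg.
Proof. by []. Qed.

Lemma galg_grouplikeM : {morph (fun g => galg_elt g \ot galg_elt g : tensor galg galg)
  : g h / (g * h)%g >-> g * h}.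
Proof. by move=> g h /=; rewrite tens_mul [_ * _]galg_mul_elt. Qed.

Definition galg_coprod : 'AHom(galg, tensor galg galg) :=
  glift_ahom galg_grouplike1 galg_grouplikeM.
Definition galg_counit : 'AHom(galg, K^o) :=
  @glift_ahom K^o (fun=> 1) (erefl 1) (fun _ _ => esym (mulr1 1)).

Lemma galg_coprodA f :
  tassoc galg galg galg (tmap galg_coprod \1%VF (galg_coprod f)) =
  tmap \1%VF galg_coprod (galg_coprod f).
Proof.
move: f; apply: linear_galg_ext => [c f h|c f h|g].
- by rewrite !linearP.
- by rewrite !linearP.
by rewrite !glift_ahomE !tmap_tens !id_lfunE !glift_ahomE tassoc_tens.
Qed.

Lemma galg_counitl f : tlift (fun u v => galg_counit u *: v) (galg_coprod f) = f.
Proof.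
move: f; apply: linear_galg_ext => [c f h|//|g]; first by rewrite !linearP.
rewrite glift_ahomE tlift_tens ?glift_ahomE ?scale1r //.
split=> [u|v] c x y; first exact: (bilin_scale _).1.
by rewrite linearP; apply: (bilin_scale _).2.
Qed.

Lemma galg_counitr f : tlift (fun u v => galg_counit v *: u) (galg_coprod f) = f.
Proof.
move: f; apply: linear_galg_ext => [c f h|//|g]; first by rewrite !linearP.
rewrite glift_ahomE tlift_tens ?glift_ahomE ?scale1r //.
split=> [u|v] c x y; last exact: (bilin_scale _).1.
by rewrite linearP; apply: (bilin_scale _).2.
Qed.

Definition group_bialgebra : bialgebra galg :=
  Bialgebra galg_coprodA galg_counitl galg_counitr.

End GroupAlgebra.

(* Main.v *)
Require Import Defs.
From HB Require Import structures.
From mathcomp Require Import all_boot all_order all_algebra all_fingroup all_field.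

Set Implicit Arguments.
Unset Strict Implicit.
Unset Printing Implicit Defensive.

Import GRing.Theory.
Local Open Scope ring_scope.

(* The augmentation ideal of F_2[x]/<x^4> is its nilradical, so the counit
   kills x and the counit laws leave nine free coefficients of Delta x in the
   basis x^i (x) x^j. Coassociativity is a finite system in these nine bits
   with eight solutions, and the substitutions x |-> x + b x^2 + c x^3 carry
   each of them to one of the four normal forms. Antipodes and automorphisms
   are algebra maps, hence determined by the image of x, so every existence or
   non-existence claim is likewise a search over coordinates in F_2.
   Self-duality of (i), (ii) and (iii) fails because no f in their duals has
   f^4 = 0 and f^3 <> 0, as x does. For (iv), x is sent to the element of the
   dual basis dual to x^2. *)

(** * Transport of bialgebras *)

Section Transport.
Variable K : fieldType.

(** The image of an injective map has the dimension of the source, so equal dimensions make it the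
    whole target. *)
Lemma lfun_inj_bij (U V : vectType K) (f : 'Hom(U, V)) :
  injective f -> \dim {:U} = \dim {:V} -> bijective f.
Proof.
move=> f_inj dimUV; have kf : lker f == 0%VS by apply/lker0P.
exists (f^-1)%VF => [u|v]; first exact: lker0_lfunK.
apply: limg_lfunVK; suff /eqP-> : limg f == fullv by rewrite memvf.
by rewrite eqEdim subvf limg_dim_eq ?dimUV //= (eqP kf) capv0.
Qed.

(** Linearity and multiplicativity of the inverse may be checked after applying [f], which is
    injective. *)
Lemma ahom_inverse (A H : falgType K) (f : 'AHom(A, H)) : bijective f ->
  exists g : 'AHom(H, A), cancel f g /\ cancel g f.
Proof.
move=> [g fK gK].
have f_inj := can_inj fK.
have g_linear : linear g.
  by move=> c u v; apply: f_inj; rewrite linearP /= !gK.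
pose gL : {linear H -> A} := HB.pack g (GRing.isLinear.Build _ _ _ _ g g_linear).
have g_ahom : ahom_in fullv (linfun gL).
  apply/ahom_inP; split=> [u v _ _|]; rewrite !lfunE /=; apply: f_inj.
    by rewrite rmorphM /= !gK.
  by rewrite gK rmorph1.
by exists (AHom g_ahom); split=> u; rewrite lfunE /=.
Qed.

Lemma tmap_tmap (A A' A'' B B' B'' : vectType K) (f : 'Hom(A, A'))
    (f' : 'Hom(A', A'')) (g : 'Hom(B, B')) (g' : 'Hom(B', B'')) X :
  tmap f' g' (tmap f g X) = tmap (f' \o f) (g' \o g) X.
Proof.
rewrite [LHS]tlift_tmap; last by apply: bilin_comp; [exact: tensP|exact: linearP..].
by apply: tlift_bilin_ext => a b; rewrite !comp_lfunE.
Qed.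

Lemma eq_tmap (A A' B B' : vectType K) (f f' : 'Hom(A, A')) (g g' : 'Hom(B, B')) X :
  f =1 f' -> g =1 g' -> tmap f g X = tmap f' g' X.
Proof. by move=> ef eg; apply: tlift_bilin_ext => a b; rewrite ef eg. Qed.

Lemma tmap_id (A B : vectType K) (X : tensor A B) : tmap \1%VF \1%VF X = X.
Proof.
move: X; apply: linear_tens_ext => [||u v]; [exact: linearP|by []|].
by rewrite tmap_tens !id_lfunE.
Qed.

Lemma tassoc_tmap (A A' B B' C C' : vectType K) (f : 'Hom(A, A'))
    (g : 'Hom(B, B')) (h : 'Hom(C, C')) X :
  tassoc A' B' C' (tmap (tmap f g) h X) = tmap f (tmap g h) (tassoc A B C X).
Proof.
move: X; apply: linear_tens_ext => [c X Y|c X Y|T w]; rewrite ?linearP //.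
move: T; apply: linear_tens_ext => [c X Y|c X Y|u v].
- by rewrite (tensP _ _).2 !linearP.
- by rewrite (tensP _ _).2 !linearP.
by rewrite !(tassoc_tens, tmap_tens).
Qed.

Lemma tmap_is_monoid_morphism (A B A' B' : falgType K) (f : 'AHom(A, A'))
  (g : 'AHom(B, B')) : monoid_morphism (tmap f g).
Proof.
split=> [|X Y]; first by rewrite -tens_one tmap_tens !rmorph1.
move: X; apply: linear_tens_ext => [c X X'|c X X'|u v].
- by rewrite linear_mulr linearP.
- by rewrite linearP linear_mulr.
move: Y; apply: linear_tens_ext => [c Y Y'|c Y Y'|u' v'].
- by rewrite linear_mull linearP.
- by rewrite linearP linear_mull.
by rewrite tens_mul !tmap_tens !rmorphM tens_mul.
Qed.

(** The structure is pulled back along [f]: with [g] the inverse of [f], the coproduct is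
    [tmap g g \o (coprod B \o f)] and the counit is [counit B \o f]. This reduces the classification
    over all algebras isomorphic to [A] to structures on [A] itself. *)
Lemma bialgebra_transport (A H : falgType K) (f : 'AHom(A, H)) (B : bialgebra H) :
  bijective f -> exists B' : bialgebra A, is_bialg_iso B' B f.
Proof.
move=> f_bij; have [g [fK gK]] := ahom_inverse f_bij.
pose D : 'Hom(A, tensor A A) := (tmap g g \o (coprod B \o f))%VF.
have DE a : D a = tmap g g (coprod B (f a)) by rewrite !comp_lfunE.
have [tg1 tgM] := tmap_is_monoid_morphism g g.
have D_ahom : ahom_in fullv D.
  by apply/ahom_inP; split=> [u v _ _|]; rewrite !DE ?rmorphM ?tgM ?rmorph1 ?tg1.
have e_ahom : ahom_in fullv (counit B \o f)%VF.
  by apply/ahom_inP; split=> [u v _ _|]; rewrite !comp_lfunE ?rmorphM ?rmorph1.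
have DA a : tassoc A A A (tmap D \1%VF (D a)) = tmap \1%VF D (D a).
  rewrite DE [in LHS]tmap_tmap [RHS]tmap_tmap.
  (* Since [f] undoes [g], composing [D] with [g] gives [tmap g g \o coprod B]. Both sides of
     coassociativity become the image, under [g] on all three factors, of the law for [B]. *)
  rewrite (@eq_tmap _ _ _ _ _ (tmap g g \o coprod B)%VF _ (g \o \1)%VF); first last.
  - by move=> u; rewrite !comp_lfunE !id_lfunE.
  - by move=> u; rewrite !comp_lfunE /= gK.
  rewrite -[in LHS]tmap_tmap tassoc_tmap coprodA tmap_tmap; apply: eq_tmap => u.
    by rewrite !comp_lfunE !id_lfunE.
  by rewrite !comp_lfunE /= gK.
have el a : tlift (fun u v => (counit B \o f)%VF u *: v) (D a) = a.
  rewrite DE tlift_tmap; last first.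
    split=> u c v w; first exact: (bilin_scale _).1.
    by rewrite linearP; apply: (bilin_scale _).2.
  rewrite -[RHS]fK -[f a in RHS](counitl B) (linear_tlift _ _ (linearP g)).
  by apply: tlift_bilin_ext => u v; rewrite comp_lfunE /= gK linearZ.
have er a : tlift (fun u v => (counit B \o f)%VF v *: u) (D a) = a.
  rewrite DE tlift_tmap; last first.
    split=> u c v w; first by rewrite linearP; apply: (bilin_scale _).2.
    exact: (bilin_scale _).1.
  rewrite -[RHS]fK -[f a in RHS](counitr B) (linear_tlift _ _ (linearP g)).
  by apply: tlift_bilin_ext => u v; rewrite comp_lfunE /= gK linearZ.
exists (@Bialgebra _ _ (AHom D_ahom) (AHom e_ahom) DA el er).
split=> // a /=; last by rewrite comp_lfunE.
rewrite DE tmap_tmap -[LHS]tmap_id; apply: eq_tmap => u;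
  by rewrite comp_lfunE id_lfunE gK.
Qed.

Lemma bialg_iso_trans (A A' A'' : falgType K) (B : bialgebra A) (B' : bialgebra A')
  (B'' : bialgebra A'') : bialg_iso B B' -> bialg_iso B' B'' -> bialg_iso B B''.
Proof.
move=> [f [f_bij fD fe]] [g [g_bij gD ge]].
exists (comp_ahom g f); split=> [|a|a]; rewrite ?comp_lfunE ?ge ?fe //.
  apply: (eq_bij (bij_comp g_bij f_bij)) => a; by rewrite comp_lfunE.
by rewrite gD fD tmap_tmap.
Qed.

(** The antipode is conjugated by the isomorphism [f], with [g] its inverse. *)
Lemma is_hopf_iso (A H : falgType K) (B : bialgebra A) (B' : bialgebra H) :
  bialg_iso B B' -> is_hopf B -> is_hopf B'.
Proof.
move=> [f [/ahom_inverse[g [fK gK]] fD fe]] [S aS].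
exists (f \o (S \o g))%VF => h; rewrite -(gK h) fD fe.
have [aSl aSr] := aS (g h).
have fZ c : f c%:A = c%:A by rewrite linearZ /= rmorph1.
split; rewrite tlift_tmap.
- rewrite -fZ -aSl (linear_tlift _ _ (linearP f)).
  by apply: tlift_bilin_ext => u v; rewrite !comp_lfunE rmorphM /= fK.
- by apply: bilin_comp; [split=> u; [exact: linear_mull|exact: linear_mulr]|exact: linearP|].
- rewrite -fZ -aSr (linear_tlift _ _ (linearP f)).
  by apply: tlift_bilin_ext => u v; rewrite !comp_lfunE rmorphM /= fK.
- by apply: bilin_comp; [split=> u; [exact: linear_mull|exact: linear_mulr]|by []|exact: linearP].
Qed.

End Transport.

(** * Coordinates on K[x]/<x^4> and its tensor powers *)

Section TruncatedPolynomials.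
Variable K : fieldType.
Local Notation A := {poly %/ 'X^4 : {poly K}}.
Local Notation x := ('qX : A).

Definition qc (i : nat) (a : A) : K^o := (a : {poly K})`_i.

Lemma qc_linear i : linear (qc i).
Proof. by move=> c a b; rewrite /qc /= coefD coefZ. Qed.
HB.instance Definition _ i := GRing.isLinear.Build K A K^o *:%R (qc i) (qc_linear i).

Lemma mk_monicX4 : mk_monic 'X^4 = 'X^4 :> {poly K}.
Proof. exact: mk_monic_Xn. Qed.

Lemma size_qpoly4 (a : A) : (size (a : {poly K}) <= 4)%N.
Proof. by rewrite (leq_trans (size_npoly a)) // mk_monicX4 size_polyXn. Qed.

Lemma qpolyM_modX4 (a b : A) : exists q : {poly K},
  (a : {poly K}) * (b : {poly K}) = q * 'X^4 + ((a * b)%R : A).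
Proof.
exists (Pdiv.Ring.rdivp ((a : {poly K}) * (b : {poly K})) (mk_monic 'X^4)).
apply: etrans (Pdiv.RingMonic.rdivp_eq (monic_mk_monic 'X^4) _) _.
by congr (_ * _ + _); apply: mk_monicX4.
Qed.

(** Reduction modulo [X^4] leaves the coefficients of degree below 4 unchanged, so the Cauchy
    product formula survives in this range. *)
Lemma qcM k (a b : A) : (k < 4)%N ->
  qc k (a * b) = \sum_(i < k.+1) qc i a * qc (k - i) b.
Proof.
move=> ltk4; have [q e] := qpolyM_modX4 a b.
by have := congr1 (fun p : {poly K} => p`_k) e; rewrite coefM coefD coefMXn ltk4 add0r.
Qed.

Lemma qc_inj (a b : A) : (forall i, (i < 4)%N -> qc i a = qc i b) -> a = b.
Proof.
move=> e; apply/val_inj/polyP=> i /=; have [/e//|le4i] := ltnP i 4.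
by rewrite !nth_default // (leq_trans (size_qpoly4 _)).
Qed.

Lemma qcX i k : (i < 4)%N -> qc k (x ^+ i) = (k == i)%:R.
Proof.
move=> lti4; rewrite /qc /qpolyX -rmorphXn in_qpoly_small ?coefXn //.
by rewrite mk_monicX4 !size_polyXn ltnS.
Qed.

Lemma qc_sum (a : A) : a = \sum_(i < 4) qc i a *: x ^+ i.
Proof.
apply: qc_inj => k ltk4; rewrite linear_sum (bigD1 (Ordinal ltk4)) //= big1 => [|i ni].
  by rewrite linearZ /= qcX // eqxx addr0; apply/esym/mulr1.
rewrite linearZ /= qcX // -[k]/(val (Ordinal ltk4)) val_eqE eq_sym (negPf ni).
exact: mulr0.
Qed.

Lemma X4_0 : x ^+ 4 = 0.
Proof.
rewrite /qpolyX -rmorphXn; apply: val_inj => /=.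
by rewrite mk_monicX4 Pdiv.RingMonic.rmodpp ?monicXn.
Qed.

Lemma dim_qpoly4 : \dim {:A} = 4%N.
Proof. by rewrite dim_polyn mk_monicX4 size_polyXn. Qed.

Lemma ahomE (R : falgType K) (f : 'AHom(A, R)) a : f a = \sum_(i < 4) qc i a *: f x ^+ i.
Proof.
rewrite {1}(qc_sum a) linear_sum; apply: eq_bigr => i _.
by rewrite linearZ /= rmorphXn.
Qed.

(** The universal property of the quotient: evaluation at [r] kills the multiples of [X^4]. With
    target the base field, [A], [A] tensor [A] or the dual of [A], it builds counits, antipodes,
    coproducts and isomorphisms alike. *)
Lemma ahom_exists (R : falgType K) (r : R) : r ^+ 4 = 0 -> exists f : 'AHom(A, R), f x = r.
Proof.
move=> r4; pose F (a : A) : R := horner_alg r (a : {poly K}).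
have F_linear : linear F by move=> c u v; rewrite /F linearP /= mulr_algl.
pose FL : {linear A -> R} := HB.pack F (GRing.isLinear.Build _ _ _ _ F F_linear).
have F_ahom : ahom_in fullv (linfun FL).
  apply/ahom_inP; split=> [u v _ _|]; rewrite !lfunE /= /F ?rmorph1 //.
  have [q e] := qpolyM_modX4 u v; rewrite -rmorphM e rmorphD rmorphM rmorphXn /=.
  by rewrite horner_algX r4 mulr0 add0r.
exists (AHom F_ahom); rewrite lfunE /= /F qpolyXE ?monicXn ?size_polyXn //.
exact: horner_algX.
Qed.

Lemma linear_qc (V : vectType K) (h : A -> V) a : linear h ->
  h a = \sum_(i < 4) qc i a *: h (x ^+ i).
Proof.
move=> lh; pose hL : {linear A -> V} := HB.pack h (GRing.isLinear.Build _ _ _ _ h lh).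
rewrite {1}(qc_sum a) -[h]/(hL : _ -> _) linear_sum.
by apply: eq_bigr => i _; rewrite linearZ.
Qed.

Definition tco i j : 'Hom(tensor A A, K^o) := tlift (fun u v : A => qc i u * qc j v).

Lemma tco_tens i j u v : tco i j (u \ot v) = qc i u * qc j v.
Proof.
rewrite /tco tlift_tens //.
by apply: bilin_comp; [exact: bilin_mul|exact: linearP|exact: linearP].
Qed.

Lemma tens_qc (X : tensor A A) :
  X = \sum_(i < 4) \sum_(j < 4) tco i j X *: (x ^+ i \ot x ^+ j).
Proof.
move: X; apply: linear_tens_ext => [//|c X Y|u v].
  rewrite scaler_sumr -big_split; apply: eq_bigr => i _ /=.
  rewrite scaler_sumr -big_split; apply: eq_bigr => j _ /=.
  by rewrite linearP scalerDl scalerA.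
rewrite [LHS](linear_qc u ((tensP _ _).2 v)); apply: eq_bigr => i _.
rewrite [X in _ *: X](linear_qc v ((tensP _ _).1 _)) scaler_sumr; apply: eq_bigr => j _.
by rewrite scalerA tco_tens.
Qed.

Lemma tlift_qc (V : vectType K) (f : A -> A -> V) X : bilin f ->
  tlift f X = \sum_(i < 4) \sum_(j < 4) tco i j X *: f (x ^+ i) (x ^+ j).
Proof.
move=> bf; rewrite {1}(tens_qc X) linear_sum; apply: eq_bigr => i _.
rewrite linear_sum; apply: eq_bigr => j _.
by rewrite linearZ /= tlift_tens.
Qed.

Lemma tco_inj (X Y : tensor A A) :
  (forall i j, (i < 4)%N -> (j < 4)%N -> tco i j X = tco i j Y) -> X = Y.
Proof.
move=> e; rewrite (tens_qc X) (tens_qc Y); apply: eq_bigr => i _.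
by apply: eq_bigr => j _; rewrite e.
Qed.

Lemma tcoM k l (X Y : tensor A A) : (k < 4)%N -> (l < 4)%N ->
  tco k l (X * Y) =
  \sum_(i < k.+1) \sum_(j < l.+1) tco i j X * tco (k - i) (l - j) Y.
Proof.
move=> ltk4 ltl4; move: X; apply: linear_tens_ext => [c X X'|c X X'|u v].
- by rewrite linear_mulr linearP.
- rewrite scaler_sumr -big_split; apply: eq_bigr => i _ /=.
  rewrite scaler_sumr -big_split; apply: eq_bigr => j _ /=.
  by rewrite linearP mulrDl -scalerAl.
move: Y; apply: linear_tens_ext => [c X X'|c X X'|u' v'].
- by rewrite linear_mull linearP.
- rewrite scaler_sumr -big_split; apply: eq_bigr => i _ /=.
  rewrite scaler_sumr -big_split; apply: eq_bigr => j _ /=.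
  by rewrite linearP mulrDr -scalerAr.
rewrite tens_mul tco_tens !qcM // big_distrlr /=; apply: eq_bigr => i _.
by apply: eq_bigr => j _; rewrite !tco_tens mulrACA.
Qed.

(** Every counit on [A] over [F_2] turns out to be [qc 0], so this and the next lemma turn the
    counit laws into conditions on row 0 and column 0 of the table of coordinates. *)
Lemma tco_slicel k X : tco 0 k X = qc k (tlift (fun u v : A => qc 0 u *: v) X).
Proof.
move: X; apply: linear_tens_ext => [||u v]; try by move=> c X Y; rewrite !linearP.
rewrite tco_tens tlift_tens ?linearZ //.
split=> w c u' v'; first exact: (bilin_scale _).1.
by rewrite linearP; apply: (bilin_scale _).2.
Qed.

Lemma tco_slicer k X : tco k 0 X = qc k (tlift (fun u v : A => qc 0 v *: u) X).
Proof.
move: X; apply: linear_tens_ext => [||u v]; try by move=> c X Y; rewrite !linearP.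
rewrite tco_tens tlift_tens ?linearZ 1?mulrC //.
split=> w c u' v'; first by rewrite linearP; apply: (bilin_scale _).2.
exact: (bilin_scale _).1.
Qed.

(** The second factor is an arbitrary space, so that taking [V] to be [A] tensor [A] reaches the
    triple tensor product. *)
Definition tslice (V : vectType K) i : 'Hom(tensor A V, V) :=
  tlift (fun (u : A) v => qc i u *: v).

Lemma tslice_tens (V : vectType K) i u (v : V) : tslice V i (u \ot v) = qc i u *: v.
Proof.
rewrite /tslice tlift_tens //.
split=> w c u' v'; first exact: (bilin_scale _).1.
by rewrite linearP; apply: (bilin_scale _).2.
Qed.

Lemma tslice_sum (V : vectType K) X : X = \sum_(i < 4) (x ^+ i \ot tslice V i X).
Proof.
move: X; apply: linear_tens_ext => [c X Y //|c X Y|u v].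
  rewrite scaler_sumr -big_split; apply: eq_bigr => i _ /=.
  by rewrite linearP (tensP _ _).1.
rewrite [LHS](linear_qc u ((tensP _ _).2 v)); apply: eq_bigr => i _.
by rewrite tslice_tens (linear_scale ((tensP _ _).1 _)).
Qed.

Definition tco3 k l j X := tco l j (tslice (tensor A A) k X).

Lemma tco3_inj X Y : (forall k l j, (k < 4)%N -> (l < 4)%N -> (j < 4)%N ->
  tco3 k l j X = tco3 k l j Y) -> X = Y.
Proof.
move=> e; rewrite (tslice_sum X) (tslice_sum Y); apply: eq_bigr => k _.
by congr (_ \ot _); apply: tco_inj => l j ltl ltj; apply: e.
Qed.

Lemma tco3_tassoc k l j T w : tco3 k l j (tassoc _ _ _ (T \ot w)) = tco k l T * qc j w.
Proof.
rewrite /tco3; move: T; apply: linear_tens_ext => [c X Y|c X Y|u v].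
- by rewrite (tensP _ _).2 !linearP.
- by rewrite linearP; apply: linear_mulr.
by rewrite tassoc_tens tslice_tens linearZ /= !tco_tens; apply: mulrA.
Qed.

Lemma tco3_tmapl k l j (D : 'Hom(A, tensor A A)) X :
  tco3 k l j (tassoc _ _ _ (tmap D \1%VF X)) = tlift (fun u v => tco k l (D u) * qc j v) X.
Proof.
have lt3 : linear (fun Z => tco3 k l j (tassoc A A A Z)).
  by move=> c Y Z; rewrite /tco3 !linearP.
apply: etrans (linear_tlift _ _ lt3) _.
by apply: tlift_bilin_ext => u v; rewrite tco3_tassoc id_lfunE.
Qed.

Lemma tco3_tmapr k l j (D : 'Hom(A, tensor A A)) X :
  tco3 k l j (tmap \1%VF D X) = tlift (fun u v => qc k u * tco l j (D v)) X.
Proof.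
have lt3 : linear (tco3 k l j) by move=> c Y Z; rewrite /tco3 !linearP.
apply: etrans (linear_tlift _ _ lt3) _.
by apply: tlift_bilin_ext => u v; rewrite /tco3 tslice_tens id_lfunE linearZ.
Qed.

End TruncatedPolynomials.
Arguments tco {K}.

(** * Boolean computations over F_2 *)

Definition bit (c : 'F_2) : bool := c != 0.

Fixpoint xorsum n (F : nat -> bool) : bool :=
  if n is m.+1 then xorsum m F (+) F m else false.

Lemma bitD a b : bit (a + b) = bit a (+) bit b.
Proof. by case: a => [[|[|?]] ?] //; case: b => [[|[|?]] ?]. Qed.

Lemma bitM a b : bit (a * b) = bit a && bit b.
Proof. by rewrite /bit mulf_eq0 negb_or. Qed.

Lemma bit_nat (b : bool) : bit b%:R = b.
Proof. by case: b. Qed.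

Lemma bit_inj : injective bit.
Proof.
by move=> [[|[|?]] ?] [[|[|?]] ?] //= _; apply: val_inj.
Qed.

Lemma bit_sum n (F : nat -> 'F_2) :
  bit (\sum_(i < n) F i) = xorsum n (fun i => bit (F i)).
Proof.
elim: n => [|n IHn]; first by rewrite big_ord0.
by rewrite big_ord_recr bitD IHn.
Qed.

Lemma eq_xorsum n F G : (forall i, (i < n)%N -> F i = G i) -> xorsum n F = xorsum n G.
Proof.
elim: n => //= n IHn eFG; rewrite eFG // IHn // => i ltin.
exact/eFG/ltnW.
Qed.

(* The functions below act on the coordinates of elements of A (sequences of
   four bits) and of A (x) A (4 x 4 tables): names ending in 1 concern A, names
   ending in 2 concern A (x) A. A linear map out of A is given by the list of
   its values at 1, x, x^2, x^3, to which app1 and app2 apply it. *)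
Fixpoint all_bits n : seq (seq bool) :=
  if n is m.+1 then map (cons true) (all_bits m) ++ map (cons false) (all_bits m)
  else [:: [::]].

Lemma mem_all_bits s : s \in all_bits (size s).
Proof.
elim: s => //= b s IHs; rewrite mem_cat; apply/orP.
by case: b; [left|right]; apply: map_f.
Qed.

Lemma size_all_bits n s : s \in all_bits n -> size s = n.
Proof.
elim: n s => [|n IHn] s /=; first by rewrite inE => /eqP->.
by rewrite mem_cat => /orP[] /mapP[t /IHn <- ->].
Qed.

Lemma all_bitsP (P : pred (seq bool)) n : all P (all_bits n) ->
  forall s, size s = n -> P s.
Proof. by move=> allP_n s sn; apply: (allP allP_n); rewrite -sn mem_all_bits. Qed.

Definition nb (s : seq bool) i := nth false s i.
Definition nb2 (m : seq (seq bool)) i j := nb (nth [::] m i) j.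
Definition nb3 (P : seq (seq (seq bool))) i := nb2 (nth [::] P i).
(** With lists tabulated to the fixed length 4, equal coordinates give equal lists, and identities
    are decided by [==]. *)
Definition mk1 (F : nat -> bool) := mkseq F 4.
Definition mk2 (F : nat -> nat -> bool) := mkseq (fun i => mk1 (F i)) 4.

Lemma nb_mk1 F i : (i < 4)%N -> nb (mk1 F) i = F i.
Proof. exact: nth_mkseq. Qed.

Lemma nb2_mk2 F i j : (i < 4)%N -> (j < 4)%N -> nb2 (mk2 F) i j = F i j.
Proof. by move=> lti ltj; rewrite /nb2 nth_mkseq // nb_mk1. Qed.

Lemma eq_mk1 F G : (forall i, (i < 4)%N -> F i = G i) -> mk1 F = mk1 G.
Proof. by move=> e; apply/eq_in_map=> i; rewrite mem_iota => /e. Qed.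

Lemma eq_mk2 F G : (forall i j, (i < 4)%N -> (j < 4)%N -> F i j = G i j) -> mk2 F = mk2 G.
Proof.
move=> e; apply/eq_in_map=> i; rewrite mem_iota => lti.
by apply: eq_mk1 => j; apply: e.
Qed.

Lemma mk1K s : size s = 4%N -> mk1 (nb s) = s.
Proof. by move=> s4; rewrite /mk1 -s4; apply: mkseq_nth. Qed.

Definition zero1 := mk1 (fun=> false).
Definition zero2 := mk2 (fun _ _ => false).
Definition unit1 n := mk1 (fun i => i == n).
Definition add1 s t := mk1 (fun i => nb s i (+) nb t i).
Definition mul1 s t := mk1 (fun k => xorsum k.+1 (fun i => nb s i && nb t (k - i))).
Definition pow1 s n := iter n (mul1 s) (unit1 0).
Definition add2 m n := mk2 (fun i j => nb2 m i j (+) nb2 n i j).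
Definition ten2 s t := mk2 (fun i j => nb s i && nb t j).
Definition mul2 m n := mk2 (fun k l => xorsum k.+1 (fun i => xorsum l.+1 (fun j =>
  nb2 m i j && nb2 n (k - i) (l - j)))).
Definition pow2 m n := iter n (mul2 m) (ten2 (unit1 0) (unit1 0)).
Definition dot1 s t := xorsum 4 (fun i => nb s i && nb t i).
(** The coordinate form of [tlift] for the bilinear form with value [F i j] at the pair [x^i],
    [x^j]. *)
Definition dot2 m (F : nat -> nat -> bool) :=
  xorsum 4 (fun i => xorsum 4 (fun j => nb2 m i j && F i j)).
Definition app1 P s := mk1 (fun k => xorsum 4 (fun i => nb s i && nb2 P i k)).
Definition app2 P s := mk2 (fun k l => xorsum 4 (fun i => nb s i && nb3 P i k l)).
Definition pows1 s := mkseq (pow1 s) 4.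
Definition pows2 m := mkseq (pow2 m) 4.
Definition tmap2 P m := mk2 (fun k l => dot2 m (fun i j => nb2 P i k && nb2 P j l)).
(** [P] lists the coproducts of the powers of [x]. The two sides are the coefficients of
    [x^k \ot (x^l \ot x^j)] after the coproduct is applied to the left or to the right factor of
    [m]. *)
Definition coassocb P m :=
  all (fun k => all (fun l => all (fun j =>
    dot2 m (fun u v => nb3 P u k l && (j == v)) ==
    dot2 m (fun u v => (k == u) && nb3 P v l j))
  (iota 0 4)) (iota 0 4)) (iota 0 4).

(** The first test lets [x |-> m] extend to an algebra map. The laws are then tried on all sixteen
    elements, row 0 and column 0 standing for the counit applied to the left and to the right
    factor. *)
Definition bialgb m := (pow2 m 4 == zero2) &&
  all (fun s => let n := app2 (pows2 m) s in
    [&& coassocb (pows2 m) n, mk1 (nb2 n 0) == s & mk1 (nb2 n ^~ 0%N) == s])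
  (all_bits 4).

(** [q] is the proposed image of [x] under an antipode that is an algebra map, so that [x^i] goes to
    [q^i]; [e] is the value of the counit times the unit. *)
Definition antipodeb m q := (pow1 q 4 == zero1) &&
  all (fun s => let n := app2 (pows2 m) s in
    let e := mk1 (fun k => (k == 0%N) && nb s 0) in
    (mk1 (fun k => dot2 n (fun i j => nb (mul1 (pow1 q i) (unit1 j)) k)) == e) &&
    (mk1 (fun k => dot2 n (fun i j => nb (mul1 (unit1 i) (pow1 q j)) k)) == e))
  (all_bits 4).

(* A conditional in place of a conjunction spares vm_compute, which
   is eager, the costly test. *)
Definition isob m m' p :=
  if [&& pow1 p 4 == zero1, nb p 0 == false &
      all (fun s => (app1 (pows1 p) s == zero1) ==> (s == zero1)) (all_bits 4)]
  then all (fun s => app2 (pows2 m') (app1 (pows1 p) s) ==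
                    tmap2 (pows1 p) (app2 (pows2 m) s)) (all_bits 4) else false.

(* The coefficients of Delta x in (i), (ii), (iii) and (iv). *)
Definition m1 := mk2 (fun i j => ((i, j) \in [:: (1, 0); (0, 1)])%N).
Definition m2 := mk2 (fun i j => ((i, j) \in [:: (1, 0); (0, 1); (1, 1)])%N).
Definition m3 := mk2 (fun i j => ((i, j) \in [:: (1, 0); (0, 1); (1, 1);
  (2, 2); (2, 3); (3, 2); (3, 3)])%N).
Definition m4 := mk2 (fun i j => ((i, j) \in [:: (1, 0); (0, 1); (2, 2)])%N).
(* The counit laws force row 0 and column 0. *)
Definition table4 s := mk2 (fun i j =>
  if i == 0%N then j == 1%N else if j == 0%N then i == 1%N
  else nb s (3 * i.-1 + j.-1)).

(* Multiplication in the dual, on coordinates in the basis dual to the x^i. *)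
Definition mulD (P : seq (seq (seq bool))) s t :=
  mk1 (fun k => dot2 (nth [::] P k) (fun i j => nb s i && nb t j)).
(** The unit of the dual is the counit, which is the functional dual to 1; hence [unit1 0]. *)
Definition powD m s n := iter n (mulD (pows2 m) s) (unit1 0).
Definition powsD m s := mkseq (powD m s) 4.

(** [q] is the image of [x] in the dual. The tests say that [q^4 = 0], that the induced map has zero
    kernel, and that it respects the counit and the coproduct. The last one pairs the coproduct of a
    functional with [x^i \ot x^j], which gives its value at [x^i * x^j]. *)
Definition self_dualb m q :=
  [&& powD m q 4 == zero1,
      all (fun s => (app1 (powsD m q) s == zero1) ==> (s == zero1)) (all_bits 4),
      all (fun s => nb (app1 (powsD m q) s) 0 == nb s 0) (all_bits 4)
    & all (fun s =>
        mk2 (fun i j => dot1 (mul1 (unit1 i) (unit1 j)) (app1 (powsD m q) s)) ==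
        tmap2 (powsD m q) (app2 (pows2 m) s)) (all_bits 4)].

Definition not_self_dualb m :=
  all (fun s => (powD m s 4 == zero1) ==> (powD m s 3 == zero1)) (all_bits 4).

(** Coassociativity is tested on [m] itself, that is, at [x] only. The isomorphisms run from a
    normal form to [m]. *)
Definition classifiedb m :=
  if coassocb (pows2 m) m then
    let iso_to mi := has (isob mi m) (all_bits 4) in
    [|| iso_to m1, iso_to m2, iso_to m3 | iso_to m4]
  else true.

(** An exhaustive check of the 512 tables that the counit laws allow. *)
Lemma all_tables_classified : all (fun s => classifiedb (table4 s)) (all_bits 9).
Proof. by vm_compute. Qed.

(** * Correctness of the computations *)

Section Coordinates.
Local Notation A := {poly %/ 'X^4 : {poly 'F_2}}.
Local Notation x := ('qX : A).
Local Notation T := (tensor A A).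

Definition rep (a : A) := mk1 (fun i => bit (qc i a)).
Definition rep2 (X : T) := mk2 (fun i j => bit (tco i j X)).

Lemma nb_rep a i : (i < 4)%N -> nb (rep a) i = bit (qc i a).
Proof. exact: nb_mk1. Qed.

Lemma nb2_rep2 X i j : (i < 4)%N -> (j < 4)%N -> nb2 (rep2 X) i j = bit (tco i j X).
Proof. exact: nb2_mk2. Qed.

Lemma size_rep a : size (rep a) = 4%N. Proof. exact: size_mkseq. Qed.

Lemma rep_inj : injective rep.
Proof.
by move=> a b e; apply: qc_inj => i lti; apply: bit_inj; rewrite -!nb_rep // e.
Qed.

Lemma rep2_inj : injective rep2.
Proof.
move=> X Y e; apply: tco_inj => i j lti ltj; apply: bit_inj.
by rewrite -!nb2_rep2 // e.
Qed.

Lemma rep_surj s : size s = 4%N -> exists a, rep a = s.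
Proof.
move=> s4; exists (\sum_(i < 4) (nb s i)%:R *: x ^+ i).
rewrite -[RHS]mk1K //; apply: eq_mk1 => k ltk.
rewrite linear_sum (bigD1 (Ordinal ltk)) //= big1 => [|i ni].
  by rewrite linearZ /= qcX // eqxx addr0 bitM bit_nat andbT.
rewrite linearZ /= qcX // -[k]/(val (Ordinal ltk)) val_eqE eq_sym (negPf ni).
exact: mulr0.
Qed.

Lemma rep0 : rep 0 = zero1.
Proof. by apply: eq_mk1 => i _; rewrite linear0. Qed.

Lemma rep2_0 : rep2 0 = zero2.
Proof. by apply: eq_mk2 => i j _ _; rewrite linear0. Qed.

Lemma rep_exp n : (n < 4)%N -> rep (x ^+ n) = unit1 n.
Proof. by move=> ltn4; apply: eq_mk1 => i _; rewrite qcX // bit_nat. Qed.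

Lemma rep1 : rep 1 = unit1 0.
Proof. by rewrite -(expr0 x) rep_exp. Qed.

Lemma repX : rep x = unit1 1.
Proof. by rewrite -[x]expr1 rep_exp. Qed.

Lemma repD a b : rep (a + b) = add1 (rep a) (rep b).
Proof. by apply: eq_mk1 => i lti; rewrite linearD bitD !nb_rep. Qed.

Lemma repM a b : rep (a * b) = mul1 (rep a) (rep b).
Proof.
apply: eq_mk1 => k ltk; rewrite qcM // (bit_sum _ (fun i => qc i a * qc (k - i) b)).
apply: eq_xorsum => i leik.
by rewrite bitM !nb_rep // ?(leq_trans leik) // (leq_ltn_trans (leq_subr _ _)).
Qed.

Lemma rep_pow a n : rep (a ^+ n) = pow1 (rep a) n.
Proof. by elim: n => [|n IHn]; rewrite ?rep1 // exprS repM IHn. Qed.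

Lemma rep2D X Y : rep2 (X + Y) = add2 (rep2 X) (rep2 Y).
Proof. by apply: eq_mk2 => i j lti ltj; rewrite linearD bitD !nb2_rep2. Qed.

Lemma rep2_tens a b : rep2 (a \ot b) = ten2 (rep a) (rep b).
Proof. by apply: eq_mk2 => i j lti ltj; rewrite tco_tens bitM !nb_rep. Qed.

Lemma rep2M X Y : rep2 (X * Y) = mul2 (rep2 X) (rep2 Y).
Proof.
apply: eq_mk2 => k l ltk ltl; rewrite tcoM //.
rewrite (bit_sum _ (fun i => \sum_(j < l.+1) tco i j X * tco (k - i) (l - j) Y)).
apply: eq_xorsum => i leik.
rewrite (bit_sum _ (fun j => tco i j X * tco (k - i) (l - j) Y)).
apply: eq_xorsum => j lejl.
have ltki : (k - i < 4)%N by apply: leq_ltn_trans (leq_subr _ _) ltk.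
have ltlj : (l - j < 4)%N by apply: leq_ltn_trans (leq_subr _ _) ltl.
by rewrite bitM !nb2_rep2 // ?(leq_trans leik) ?(leq_trans lejl).
Qed.

Lemma rep2_pow X n : rep2 (X ^+ n) = pow2 (rep2 X) n.
Proof.
elim: n => [|n IHn]; first by rewrite /pow2 /= -rep1 -rep2_tens.
by rewrite exprS rep2M IHn.
Qed.

Lemma bit_linear (h : A -> ('F_2)^o) a : linear h ->
  bit (h a) = xorsum 4 (fun i => nb (rep a) i && bit (h (x ^+ i))).
Proof.
move=> lh; rewrite (linear_qc a lh) (bit_sum _ (fun i => qc i a * h (x ^+ i))).
by apply: eq_xorsum => i lti; rewrite bitM nb_rep.
Qed.

Lemma bit_tlift (f : A -> A -> ('F_2)^o) X : bilin f ->
  bit (tlift f X) = dot2 (rep2 X) (fun i j => bit (f (x ^+ i) (x ^+ j))).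
Proof.
move=> bf; rewrite (tlift_qc X bf).
rewrite (bit_sum _ (fun i => \sum_(j < 4) tco i j X *: f (x ^+ i) (x ^+ j))).
apply: eq_xorsum => i lti.
rewrite (bit_sum _ (fun j => tco i j X * f (x ^+ i) (x ^+ j))).
by apply: eq_xorsum => j ltj; rewrite bitM nb2_rep2.
Qed.

Lemma eq_dot2 m F G : (forall i j, (i < 4)%N -> (j < 4)%N -> F i j = G i j) ->
  dot2 m F = dot2 m G.
Proof.
by move=> e; apply: eq_xorsum => i lti; apply: eq_xorsum => j ltj; rewrite e.
Qed.

Lemma bit_tliftM X (f g : A -> ('F_2)^o) : linear f -> linear g ->
  bit (tlift (fun u v => f u * g v) X) =
  dot2 (rep2 X) (fun i j => bit (f (x ^+ i)) && bit (g (x ^+ j))).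
Proof.
move=> lf lg; rewrite bit_tlift; last by apply: bilin_comp => //; exact: bilin_mul.
by apply: eq_dot2 => i j _ _; rewrite bitM.
Qed.

(** An algebra map sends [x^i] to the [i]-th power of the image of [x], so the coordinates of that
    one image determine it. *)
Lemma rep_ahom (f : 'AHom(A, A)) a : rep (f a) = app1 (pows1 (rep (f x))) (rep a).
Proof.
apply: eq_mk1 => k ltk; rewrite (@bit_linear (qc k \o f)) => [|c u v /=]; last first.
  by rewrite !linearP.
apply: eq_xorsum => i lti; congr (_ && _).
by rewrite /= rmorphXn /nb2 nth_mkseq // -rep_pow nb_rep.
Qed.

Lemma nb3_rep2 (D : 'AHom(A, T)) i k l : (i < 4)%N -> (k < 4)%N -> (l < 4)%N ->
  nb3 (pows2 (rep2 (D x))) i k l = bit (tco k l (D (x ^+ i))).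
Proof.
by move=> lti ltk ltl; rewrite /nb3 nth_mkseq // -rep2_pow nb2_rep2 // rmorphXn.
Qed.

Lemma rep2_ahom (D : 'AHom(A, T)) a :
  rep2 (D a) = app2 (pows2 (rep2 (D x))) (rep a).
Proof.
apply: eq_mk2 => k l ltk ltl; rewrite (@bit_linear (tco k l \o D)) => [|c u v /=]; last first.
  by rewrite !linearP.
by apply: eq_xorsum => i lti; rewrite nb3_rep2.
Qed.

Lemma rep2_tmap (f : 'AHom(A, A)) X :
  rep2 (tmap f f X) = tmap2 (pows1 (rep (f x))) (rep2 X).
Proof.
apply: eq_mk2 => k l ltk ltl; rewrite (linear_tlift _ _ (linearP (tco k l))).
rewrite (tlift_bilin_ext (g := fun u v => qc k (f u) * qc l (f v)) X) => [|u v]; last first.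
  exact: tco_tens.
rewrite bit_tliftM => [|c u v|c u v]; rewrite ?linearP //.
apply: eq_dot2 => i j lti ltj; rewrite !rmorphXn /nb2 !nth_mkseq //.
by rewrite -!rep_pow !nb_rep.
Qed.

Lemma coassocP (D : 'AHom(A, T)) X :
  reflect (tassoc _ _ _ (tmap D \1%VF X) = tmap \1%VF D X)
          (coassocb (pows2 (rep2 (D x))) (rep2 X)).
Proof.
have el k l j : (k < 4)%N -> (l < 4)%N -> (j < 4)%N ->
    bit (tco3 k l j (tassoc _ _ _ (tmap D \1%VF X))) =
    dot2 (rep2 X) (fun u v => nb3 (pows2 (rep2 (D x))) u k l && (j == v)).
  move=> ltk ltl ltj; rewrite tco3_tmapl bit_tliftM => [|c u v|c u v]; rewrite ?linearP //.
  by apply: eq_dot2 => u v ltu ltv; rewrite qcX // bit_nat nb3_rep2.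
have er k l j : (k < 4)%N -> (l < 4)%N -> (j < 4)%N ->
    bit (tco3 k l j (tmap \1%VF D X)) =
    dot2 (rep2 X) (fun u v => (k == u) && nb3 (pows2 (rep2 (D x))) v l j).
  move=> ltk ltl ltj; rewrite tco3_tmapr bit_tliftM => [|c u v|c u v]; rewrite ?linearP //.
  by apply: eq_dot2 => u v ltu ltv; rewrite qcX // bit_nat nb3_rep2.
apply: (iffP idP) => [/allP ok|e].
  apply: tco3_inj => k l j ltk ltl ltj; apply: bit_inj; rewrite el // er //.
  have inI n : (n < 4)%N -> n \in iota 0 4 by rewrite mem_iota.
  by have /allP/(_ l (inI _ ltl))/allP/(_ j (inI _ ltj))/eqP := ok k (inI _ ltk).
apply/allP=> k; rewrite mem_iota => ltk; apply/allP=> l; rewrite mem_iota => ltl.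
by apply/allP=> j; rewrite mem_iota => ltj; rewrite -el // -er // e.
Qed.

(** * Bialgebra structures, isomorphisms and antipodes in coordinates *)

Lemma counit0X (e : 'AHom(A, ('F_2)^o)) : e x = 0.
Proof.
have: e x ^+ 4 = 0 by rewrite -rmorphXn X4_0 rmorph0.
by move/eqP; rewrite expf_eq0 => /eqP.
Qed.

Lemma ahom_qc0 (e : 'AHom(A, ('F_2)^o)) a : e a = qc 0 a.
Proof.
rewrite ahomE big_ord_recl expr0 big1 ?addr0 => [|i _]; first exact: mulr1.
by rewrite counit0X expr0n; apply: mulr0.
Qed.

Lemma mk1_nb_rep2l X : mk1 (nb2 (rep2 X) 0) = rep (tlift (fun u v : A => qc 0 u *: v) X).
Proof. by apply: eq_mk1 => k ltk; rewrite nb2_rep2 // tco_slicel. Qed.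

Lemma mk1_nb_rep2r X :
  mk1 (nb2 (rep2 X) ^~ 0%N) = rep (tlift (fun u v : A => qc 0 v *: u) X).
Proof. by apply: eq_mk1 => k ltk; rewrite nb2_rep2 // tco_slicer. Qed.

Lemma bialgebra_exists (d : T) : bialgb (rep2 d) ->
  exists B : bialgebra A, counit B x = 0 /\ coprod B x = d.
Proof.
case/andP=> /eqP d4 /(all_bitsP) ok.
have [|D Dx] := @ahom_exists _ T d; first by apply: rep2_inj; rewrite rep2_pow d4 rep2_0.
have [|e _] := @ahom_exists _ (('F_2)^o : falgType _) (0 : ('F_2)^o); first exact: expr0n.
have DE a : rep2 (D a) = app2 (pows2 (rep2 d)) (rep a) by rewrite rep2_ahom Dx.
have okD a : [&& coassocb (pows2 (rep2 (D x))) (rep2 (D a)),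
    mk1 (nb2 (rep2 (D a)) 0) == rep a & mk1 (nb2 (rep2 (D a)) ^~ 0%N) == rep a].
  by rewrite Dx DE; apply: ok; apply: size_rep.
have DA a : tassoc A A A (tmap D \1%VF (D a)) = tmap \1%VF D (D a).
  by have /and3P[/coassocP] := okD a.
have el a : tlift (fun u v => e u *: v) (D a) = a.
  have /and3P[_ /eqP + _] := okD a; rewrite mk1_nb_rep2l => /rep_inj {2}<-.
  by apply: tlift_bilin_ext => u v; rewrite ahom_qc0.
have er a : tlift (fun u v => e v *: u) (D a) = a.
  have /and3P[_ _ /eqP] := okD a; rewrite mk1_nb_rep2r => /rep_inj {2}<-.
  by apply: tlift_bilin_ext => u v; rewrite ahom_qc0.
by exists (Bialgebra DA el er); split=> //; apply: counit0X.
Qed.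

Lemma rep2_coprodX (B : bialgebra A) :
  exists2 s, size s = 9%N & rep2 (coprod B x) = table4 s.
Proof.
(* The entry in row [i] and column [j], both positive, sits at position [3 * (i - 1) + (j - 1)];
   quotient and remainder by 3 recover the indices, shifted by one. *)
exists (mkseq (fun n => nb2 (rep2 (coprod B x)) (n %/ 3).+1 (n %% 3).+1) 9).
  exact: size_mkseq.
have el : mk1 (nb2 (rep2 (coprod B x)) 0) = unit1 1.
  rewrite -repX -[x in RHS](counitl B) mk1_nb_rep2l; congr rep.
  by apply: tlift_bilin_ext => u v; rewrite ahom_qc0.
have er : mk1 (nb2 (rep2 (coprod B x)) ^~ 0%N) = unit1 1.
  rewrite -repX -[x in RHS](counitr B) mk1_nb_rep2r; congr rep.
  by apply: tlift_bilin_ext => u v; rewrite ahom_qc0.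
apply: eq_mk2 => i j lti ltj; rewrite -nb2_rep2 //.
case: eqP => [->|/eqP i_neq0].
  by rewrite -(nb_mk1 (nb2 (rep2 _) 0)) // el nb_mk1.
case: eqP => [->|/eqP j_neq0].
  by rewrite -(nb_mk1 (nb2 (rep2 _) ^~ 0%N)) // er nb_mk1.
case: i lti i_neq0 => // i lti _; case: j ltj j_neq0 => // j ltj _ /=.
rewrite /nb nth_mkseq; last first.
  by move: lti ltj; rewrite !ltnS; move: i j => [|[|[|?]]] [|[|[|?]]].
by rewrite mulnC divnMDl // modnMDl divn_small ?modn_small ?addn0.
Qed.

(** An isomorphism is fixed by the coordinates of [f x], so sixteen candidates settle both existence
    and non-existence. *)
Lemma bialg_isoP (B B' : bialgebra A) :
  reflect (bialg_iso B B')
    (has (isob (rep2 (coprod B x)) (rep2 (coprod B' x))) (all_bits 4)).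
Proof.
apply: (iffP hasP) => [[p p_in]|[f [f_bij fD fe]]].
  have [a ea] := rep_surj (size_all_bits p_in).
  rewrite /isob; case: ifP => // /and3P[/eqP p4 /eqP p0 /all_bitsP p_inj] /all_bitsP pD.
  have [|f fx] := @ahom_exists _ A a; first by apply: rep_inj; rewrite rep_pow ea p4 rep0.
  have fE u : rep (f u) = app1 (pows1 p) (rep u) by rewrite rep_ahom fx ea.
  have f_inj : injective f.
    apply/lker0P; rewrite -subv0; apply/subvP => u; rewrite memv_ker memv0 => /eqP fu0.
    have := p_inj (rep u) (size_rep u); rewrite -fE fu0 rep0 eqxx /= => /eqP u0.
    by apply/eqP/rep_inj; rewrite u0 rep0.
  exists f; split=> [|u|u]; first exact: lfun_inj_bij.
    apply: rep2_inj; rewrite rep2_ahom fE rep2_tmap [in RHS]rep2_ahom fx ea.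
    by apply/eqP/pD/size_rep.
  (* Both counits are [qc 0], so it is enough that positive powers of [x] go to elements without
     constant term, which holds because [f x] has none. *)
  have f0_linear : linear (fun v => qc 0 (f v)) by move=> c v w; rewrite !linearP.
  rewrite !ahom_qc0 [LHS](linear_qc u f0_linear) big_ord_recl expr0.
  rewrite rmorph1 big1 ?addr0 => [|i _].
    rewrite -(expr0 x) qcX // eqxx; exact: mulr1.
  rewrite lift0 rmorphXn /= fx exprS qcM // big_ord1.
  have -> : qc 0 a = 0 by apply: bit_inj; rewrite -nb_rep // ea p0.
  by rewrite mul0r scaler0.
exists (rep (f x)); first by have := mem_all_bits (rep (f x)); rewrite size_rep.
have f0 : nb (rep (f x)) 0 = false.
  by rewrite nb_rep // -(ahom_qc0 (counit B')) fe ahom_qc0 -[x]expr1 qcX.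
rewrite /isob f0 -rep_pow -rmorphXn X4_0 rmorph0 rep0 !eqxx !andTb.
case: ifP => [_|/negP[]]; apply/allP => s /size_all_bits/rep_surj[u <-].
  rewrite -!rep_ahom -!rep2_ahom -rep2_tmap fD; exact: eqxx.
rewrite -rep_ahom; apply/implyP => /eqP fu0; rewrite -rep0; apply/eqP; congr rep.
by apply: (bij_inj f_bij); apply: rep_inj; rewrite fu0 rmorph0 rep0.
Qed.

Lemma bilin_qcM k (f g : A -> A) : linear f -> linear g ->
  bilin (fun u v => qc k (f u * g v)).
Proof.
move=> lf lg; split=> [u|v] c w w'; first by rewrite lg linear_mull linearP.
by rewrite lf linear_mulr linearP.
Qed.

Lemma antipode_exists (B : bialgebra A) (a : A) :
  antipodeb (rep2 (coprod B x)) (rep a) ->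
  exists S : 'End(A), is_antipode B S /\ S x = a.
Proof.
case/andP=> /eqP a4 /all_bitsP ok.
have [|S Sx] := @ahom_exists _ A a; first by apply: rep_inj; rewrite rep_pow a4 rep0.
exists S; split=> // u.
have SX i : rep (S (x ^+ i)) = pow1 (rep a) i by rewrite rmorphXn /= Sx rep_pow.
have eE : rep (counit B u)%:A = mk1 (fun k => (k == 0%N) && nb (rep u) 0).
  apply: eq_mk1 => k ltk; rewrite nb_rep // linearZ bitM andbC ahom_qc0.
  by congr (_ && _); rewrite -(expr0 x) /= qcX // bit_nat.
have := ok (rep u) (size_rep u); rewrite -eE -rep2_ahom => /andP[/eqP el /eqP er].
split; apply: rep_inj; [rewrite -el|rewrite -er].
  apply: eq_mk1 => k ltk.
  rewrite (linear_tlift _ _ (linearP (qc k))) bit_tlift.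
    by apply: eq_dot2 => i j lti ltj; rewrite -nb_rep // repM SX rep_exp.
  by apply: (bilin_qcM k (g := id)) => //; exact: linearP.
apply: eq_mk1 => k ltk.
rewrite (linear_tlift _ _ (linearP (qc k))) bit_tlift.
  by apply: eq_dot2 => i j lti ltj; rewrite -nb_rep // repM SX rep_exp.
by apply: (bilin_qcM k (f := id)) => //; exact: linearP.
Qed.

(** * The dual Hopf algebra in coordinates *)

Section Dual.
Variable B : bialgebra A.
Local Notation m := (rep2 (coprod B x)).
(** The type [dual A] does not mention [B] while its product depends on it, so the algebra structure
    is named explicitly. *)
Local Notation H := (Defs_dual__canonical__falgebra_Falgebra B : falgType _).
Implicit Types f g : H.

Definition drep f := mk1 (fun i => bit (fun_of_lfun f (x ^+ i))).

Lemma nb_drep f i : (i < 4)%N -> nb (drep f) i = bit (fun_of_lfun f (x ^+ i)).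
Proof. exact: nb_mk1. Qed.

Lemma bit_dual f a : bit (fun_of_lfun f a) = dot1 (rep a) (drep f).
Proof.
rewrite (bit_linear a (dual_linear f)); apply: eq_xorsum => i lti.
by rewrite nb_drep.
Qed.

Lemma drep_inj : injective drep.
Proof. by move=> f g e; apply: dualP => a; apply: bit_inj; rewrite !bit_dual e. Qed.

Lemma drep0 : drep 0 = zero1.
Proof. by apply: eq_mk1 => i _; rewrite zero_lfunE. Qed.

Lemma drep1 : drep 1 = unit1 0.
Proof. by apply: eq_mk1 => i lti; rewrite [fun_of_lfun _ _]ahom_qc0 qcX // bit_nat eq_sym. Qed.

Lemma rep2_coprod_exp i : (i < 4)%N ->
  rep2 (coprod B (x ^+ i)) = nth [::] (pows2 m) i.
Proof. by move=> lti; rewrite rmorphXn nth_mkseq // rep2_pow. Qed.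

Lemma drepM f g : drep (f * g) = mulD (pows2 m) (drep f) (drep g).
Proof.
apply: eq_mk1 => k ltk; rewrite [fun_of_lfun _ _]dual_mulE /fpair.
rewrite bit_tliftM; try exact: dual_linear.
by rewrite rep2_coprod_exp //; apply: eq_dot2 => i j lti ltj; rewrite !nb_drep.
Qed.

Lemma drep_pow f n : drep (f ^+ n) = powD m (drep f) n.
Proof. by elim: n => [|n IHn]; rewrite ?drep1 // exprS drepM IHn. Qed.

Lemma not_self_dual : not_self_dualb m -> ~ self_dual B.
Proof.
move/all_bitsP=> ok [f [f_bij _ _]].
have f4 : f x ^+ 4 = 0 by rewrite -rmorphXn X4_0 rmorph0.
have := ok (drep (f x)) (size_mkseq _ _).
rewrite -!drep_pow f4 drep0 eqxx /= -drep0 => /eqP/drep_inj f3.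
have x3 : x ^+ 3 = 0 by apply: (bij_inj f_bij); rewrite rmorph0 rmorphXn.
by have := congr1 rep x3; rewrite rep_exp // rep0.
Qed.

(** The powers of [x] span [A], so pairing with them already separates tensors. *)
Lemma dual_ev_inj_exp (X Y : tensor H H) : (forall i j, (i < 4)%N -> (j < 4)%N ->
  dual_ev (x ^+ i) (x ^+ j) X = dual_ev (x ^+ i) (x ^+ j) Y) -> X = Y.
Proof.
move=> e; apply: dual_ev_inj => u v.
rewrite !(linear_qc u ((dual_ev_param _).2 v)); apply: eq_bigr => i _; congr (_ *: _).
rewrite !(linear_qc v ((dual_ev_param _).1 _)); apply: eq_bigr => j _; congr (_ *: _).
exact: e.
Qed.

Lemma self_dual_exists f : self_dualb m (drep f) -> self_dual B.
Proof.
case/and4P=> /eqP f4 /all_bitsP f_inj /all_bitsP fe /all_bitsP fD.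
have [|F Fx] := @ahom_exists _ H f; first by apply: drep_inj; rewrite drep_pow f4 drep0.
have FE a : drep (F a) = app1 (powsD m (drep f)) (rep a).
  apply: eq_mk1 => k ltk.
  have lF : linear (fun a => fun_of_lfun (F a) (x ^+ k)).
    by move=> c u v; rewrite linearP dual_eval.
  rewrite (bit_linear a lF); apply: eq_xorsum => i lti; congr (_ && _).
  by rewrite rmorphXn /= Fx /nb2 nth_mkseq // -drep_pow nb_drep.
exists F; split=> [|a|a].
(* The space of maps from [A] to the base field has the dimension of [A] times 1, so injectivity
   suffices. *)
- apply: lfun_inj_bij; last by rewrite !dimvf; apply: (esym (muln1 _)).
  apply/lker0P; rewrite -subv0; apply/subvP => u; rewrite memv_ker memv0 => /eqP fu0.
  have := f_inj (rep u) (size_rep u); rewrite -FE fu0 drep0 eqxx /= => /eqP u0.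
  by apply/eqP/rep_inj; rewrite u0 rep0.
- apply: dual_ev_inj_exp => i j lti ltj; rewrite dual_coprodP.
  rewrite (linear_tlift _ _ (linearP (dual_ev (x ^+ i) (x ^+ j)))).
  rewrite (tlift_bilin_ext (g := fun b c =>
      fun_of_lfun (F b) (x ^+ i) * fun_of_lfun (F c) (x ^+ j))); last first.
    by move=> b c; apply: dual_ev_tens.
  apply: bit_inj; rewrite bit_dual FE repM !rep_exp //.
  have /eqP := fD (rep a) (size_rep a) => /(congr1 (fun n => nb2 n i j)).
  rewrite !nb2_mk2 // => ->.
  rewrite bit_tliftM; try by move=> c b b'; rewrite linearP dual_eval.
  rewrite -rep2_ahom; apply: eq_dot2 => k l ltk ltl.
  by rewrite /nb2 !nth_mkseq // -!drep_pow !nb_drep // !rmorphXn /= Fx.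
rewrite dual_counitP ahom_qc0; apply: bit_inj.
by rewrite -(expr0 x) -nb_drep // FE -nb_rep //; apply/eqP/fe/size_rep.
Qed.

End Dual.

(** In characteristic 2, [(1 + x)^4 = 1 + x^4 = 1], so the powers of [1 + x] define a map from the
    cyclic group of order 4. They are grouplike and form a basis of [A]. *)
Lemma group_bialgebra_iso (B : bialgebra A) : grouplike B (1 + x) ->
  exists f : 'AHom(galg 'F_2 'Z_4, A),
    is_bialg_iso (group_bialgebra 'F_2 'Z_4) B f /\
    f (galg_elt 'F_2 (Zp1 : 'Z_4)) = 1 + x.
Proof.
set s := 1 + x => -[sD se].
have s4 : s ^+ 4 = 1 by apply: rep_inj; rewrite rep_pow repD rep1 repX.
pose F (g : 'Z_4) : A := s ^+ (g : nat).
(* The group law of ['Z_4] is addition of residues, so [1%g] is the residue 0. *)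
have F1 : F 1%g = 1 by [].
have FM : {morph F : g h / (g * h)%g >-> g * h}.
  by move=> g h; rewrite /F -exprD -[RHS](expr_mod _ s4).
pose f := glift_ahom F1 FM.
have fE g : f (galg_elt 'F_2 g) = s ^+ (g : nat) by apply: glift_ahomE.
have fDe g : coprod B (f (galg_elt 'F_2 g)) = s ^+ g \ot s ^+ g /\
             counit B (f (galg_elt 'F_2 g)) = 1.
  rewrite fE [counit B _]rmorphXn /= se expr1n; split=> //.
  elim: (g : nat) => [|n IHn]; first by rewrite !expr0 rmorph1.
  by rewrite (exprS s) rmorphM /= IHn sD tens_mul.
exists f; split; last exact: fE.
split.
- apply: lfun_inj_bij; last first.
    by rewrite dim_qpoly4 dimvf; apply: etrans (muln1 _) _; apply: card_ord.
  apply/lker0P; rewrite -subv0; apply/subvP => c; rewrite memv_ker memv0 => /eqP fc0.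
  (* The coordinates of [c], with the group elements ordered by residue. *)
  pose t := mk1 (fun i => bit (c (inZp i))).
  have fc : rep (f c) = app1 (pows1 (rep s)) t.
    have -> : f c = \sum_(g : 'Z_4) c g *: F g by rewrite lfunE.
    apply: eq_mk1 => k ltk; rewrite linear_sum.
    transitivity (bit (\sum_(i < 4) c (inZp i) * qc k (s ^+ i))).
      by congr bit; apply: eq_bigr => i _; rewrite linearZ /= valZpK.
    rewrite (bit_sum _ (fun i => c (inZp i) * qc k (s ^+ i))).
    apply: eq_xorsum => i lti; rewrite bitM nb_mk1 // /nb2 nth_mkseq //.
    by rewrite -rep_pow nb_rep.
  (* Linear independence of [1, s, s^2, s^3], by trying all sixteen combinations. *)
  have inj : all (fun t => (app1 (pows1 (rep s)) t == zero1) ==> (t == zero1)) (all_bits 4).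
    by rewrite repD rep1 repX; vm_compute.
  have := all_bitsP inj (size_mkseq _ _ : size t = 4%N); rewrite -fc fc0 rep0 eqxx /=.
  move=> /eqP t0; apply/eqP/ffunP => g; rewrite ffunE; apply: bit_inj.
  have := congr1 (fun t => nb t g) t0; rewrite !nb_mk1 ?valZpK //.
- apply: linear_galg_ext => [c u v|c u v|g]; rewrite ?linearP //.
  by rewrite (fDe g).1 glift_ahomE tmap_tens fE.
- apply: linear_galg_ext => [c u v|c u v|g]; rewrite ?linearP //.
  by rewrite (fDe g).2 glift_ahomE.
Qed.

End Coordinates.

(** * Classification, antipodes and self-duality *)

Theorem mainTheorem8 :
  let A : falgType 'F_2 := {poly %/ 'X^4 : {poly 'F_2}} in
  let x : A := 'qX in
  (forall (H : falgType 'F_2) (B : bialgebra H), alg_iso A H -> is_hopf B) /\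
  exists B1 B2 B3 B4 : bialgebra A,
    (* the four structures *)
    (counit B1 x = 0 /\ coprod B1 x = x \ot 1 + 1 \ot x) /\
    (counit B2 x = 0 /\ coprod B2 x = x \ot 1 + 1 \ot x + x \ot x /\
     grouplike B2 (1 + x) /\
     exists f : 'AHom(galg 'F_2 'Z_4, A),
       is_bialg_iso (group_bialgebra 'F_2 'Z_4) B2 f /\
       f (galg_elt 'F_2 (Zp1 : 'Z_4)) = 1 + x) /\
    (counit B3 x = 0 /\
     coprod B3 x = x \ot 1 + 1 \ot x + x \ot x
                   + (x ^+ 2 + x ^+ 3) \ot (x ^+ 2 + x ^+ 3) /\
     exists S : 'End(A), is_antipode B3 S /\ S x = x + x ^+ 2 + x ^+ 3) /\
    (counit B4 x = 0 /\
     coprod B4 x = x \ot 1 + 1 \ot x + (x ^+ 2) \ot (x ^+ 2) /\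
     exists S : 'End(A), is_antipode B4 S /\ S x = x) /\
    (* they are pairwise non-isomorphic and exhaust all isomorphism classes *)
    (~ bialg_iso B1 B2 /\ ~ bialg_iso B1 B3 /\ ~ bialg_iso B1 B4 /\
     ~ bialg_iso B2 B3 /\ ~ bialg_iso B2 B4 /\ ~ bialg_iso B3 B4) /\
    (forall (H : falgType 'F_2) (B : bialgebra H), alg_iso A H ->
       [\/ bialg_iso B1 B, bialg_iso B2 B, bialg_iso B3 B | bialg_iso B4 B]) /\
    (* only the fourth is self-dual *)
    (~ self_dual B1 /\ ~ self_dual B2 /\ ~ self_dual B3 /\ self_dual B4).
Proof.
move=> A x.
pose d1 : tensor A A := x \ot 1 + 1 \ot x.
pose d2 := d1 + x \ot x.
pose d3 := d2 + (x ^+ 2 + x ^+ 3) \ot (x ^+ 2 + x ^+ 3).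
pose d4 := d1 + (x ^+ 2) \ot (x ^+ 2).
have rd1 : rep2 d1 = m1 by rewrite rep2D !rep2_tens repX rep1.
have rd2 : rep2 d2 = m2 by rewrite rep2D rd1 rep2_tens repX.
have rd3 : rep2 d3 = m3 by rewrite rep2D rd2 rep2_tens repD !rep_exp.
have rd4 : rep2 d4 = m4 by rewrite rep2D rd1 rep2_tens rep_exp.
have [|B1 [e1 D1]] := @bialgebra_exists d1; first by rewrite rd1; vm_compute.
have [|B2 [e2 D2]] := @bialgebra_exists d2; first by rewrite rd2; vm_compute.
have [|B3 [e3 D3]] := @bialgebra_exists d3; first by rewrite rd3; vm_compute.
have [|B4 [e4 D4]] := @bialgebra_exists d4; first by rewrite rd4; vm_compute.
have r1 : rep2 (coprod B1 x) = m1 by rewrite D1.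
have r2 : rep2 (coprod B2 x) = m2 by rewrite D2.
have r3 : rep2 (coprod B3 x) = m3 by rewrite D3.
have r4 : rep2 (coprod B4 x) = m4 by rewrite D4.
have [|S1 [hS1 _]] := @antipode_exists B1 x; first by rewrite r1 repX; vm_compute.
(* The antipode inverts the grouplike [s = 1 + x], so [x = s - 1] goes to
   [s^3 - 1 = x + x^2 + x^3]. *)
have [|S2 [hS2 _]] := @antipode_exists B2 (x + x ^+ 2 + x ^+ 3).
  by rewrite r2 !repD !rep_exp // repX; vm_compute.
have [|S3 [hS3 S3x]] := @antipode_exists B3 (x + x ^+ 2 + x ^+ 3).
  by rewrite r3 !repD !rep_exp // repX; vm_compute.
have [|S4 [hS4 S4x]] := @antipode_exists B4 x; first by rewrite r4 repX; vm_compute.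
have classif (H : falgType 'F_2) (B : bialgebra H) : alg_iso A H ->
    [\/ bialg_iso B1 B, bialg_iso B2 B, bialg_iso B3 B | bialg_iso B4 B].
  move=> [f f_bij]; have [B' isoB'] := bialgebra_transport B f_bij.
  have B'B : bialg_iso B' B by exists f.
  have [s s9 es] := rep2_coprodX B'.
  have := all_bitsP all_tables_classified s9; rewrite -es /classifiedb.
  (* A table failing the test would contradict [coprodA] at [x]. *)
  case: ifP => [_|/coassocP[]]; last exact: coprodA.
  by rewrite -r1 -r2 -r3 -r4 => /or4P[] /bialg_isoP isoB;
    [apply: Or41|apply: Or42|apply: Or43|apply: Or44]; apply: bialg_iso_trans isoB B'B.
split=> [H B /(classif H B)[] isoB|].
- by apply: is_hopf_iso isoB _; exists S1.
- by apply: is_hopf_iso isoB _; exists S2.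
- by apply: is_hopf_iso isoB _; exists S3.
- by apply: is_hopf_iso isoB _; exists S4.
exists B1, B2, B3, B4; split; first by [].
have s_grouplike : grouplike B2 (1 + x).
  split; last by rewrite rmorphD rmorph1 /= e2 addr0.
  apply: rep2_inj; rewrite rmorphD rmorph1 /= D2 -tens_one.
  by rewrite rep2D rd2 !rep2_tens !repD rep1 repX.
split; first by do 3!split=> //; exact: group_bialgebra_iso.
split; first by do 2!split=> //; exists S3.
split; first by do 2!split=> //; exists S4.
(* Each isomorphism is refuted by running through the sixteen candidate images of [x]. *)
split; first by do !split; move/bialg_isoP; rewrite ?r1 ?r2 ?r3 ?r4; vm_compute.
split; first exact: classif.
have nsd (B : bialgebra A) m : rep2 (coprod B x) = m -> not_self_dualb m -> ~ self_dual B.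
  by move=> <-; apply: not_self_dual.
(* For example, in the dual of (i) every nilpotent has square zero, and the dual of (ii) is the
   algebra of functions on the cyclic group of order 4, which has no nonzero nilpotents. *)
do 3![split; first by [apply: nsd r1 _; vm_compute | apply: nsd r2 _; vm_compute
                      | apply: nsd r3 _; vm_compute]].
(* In the dual of (iv), [z^2] and [z^3] are dual to [x] and [x^3], because [x^2 \ot x^2] occurs only
   in the coproduct of [x] and [x^2 \ot x] only in that of [x^3]. Moreover [z^4 = 0], because
   [x \ot x] has coefficient 2 in the coproduct of [x^2]. *)
pose z : dual A := linfun (qc 2 : A -> ('F_2)^o).
apply: (@self_dual_exists B4 z).
have -> : drep (B := B4) z = unit1 2.
  by apply: eq_mk1 => i lti; rewrite lfunE /= qcX // bit_nat eq_sym.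
by rewrite r4; vm_compute.
Qed.
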